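(* Let $\alpha>0$, $-\alpha-1<\beta<-1$ and $-\beta\notin\mathbb N$, and let $m\in\mathbb N_0$ and $N\ge 1$ be integers with $0\le m\le N$. Suppose that $D_+^{\alpha+l}u\in L^2_{\omega^{(l,\alpha+\beta+l)}}(\Lambda)$ for $0\le l\le m$. Then $$\big\|D_+^\alpha({}^+\pi_N^{(-\alpha,\beta)}u-u)\big\|_{\omega^{(0,\alpha+\beta)}}\le N^{-m/2}\sqrt{\frac{(N-m+1)!}{(N+1)!}}\;\big\|D_+^{\alpha+m}u\big\|_{\omega^{(m,\alpha+\beta+m)}}.$$ In particular, if $m$ is fixed, $$\big\|D_+^\alpha({}^+\pi_N^{(-\alpha,\beta)}u-u)\big\|_{\omega^{(0,\alpha+\beta)}}\le cN^{-m}\big\|D_+^{\alpha+m}u\big\|_{\omega^{(m,\alpha+\beta+m)}},$$ where the constant $c$ is positive, independent of $u$, and $c\approx1$ for $N\gg1$ (i.e. for fixed $\alpha,\beta,m$ one may take $c=c_N$ with $c_N\to1$ as $N\to\infty$).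
   Context: $\mathbb N=\{1,2,\dots\}$, $\mathbb N_0=\{0\}\cup\mathbb N$, $\Lambda=(-1,1)$, $\omega^{(a,b)}(x)=(1-x)^a(1+x)^b$. For a weight $\varpi>0$ on $\Lambda$, $L^2_\varpi(\Lambda)$ has inner product $(u,v)_\varpi=\int_\Lambda uv\varpi\,dx$ and norm $\|\cdot\|_\varpi$. $\mathcal P_N$ is the set of real polynomials of degree at most $N$. Right Riemann–Liouville derivative: for $s\in[j-1,j)$, $j\in\mathbb N$, $$D_+^sv(x)=\frac{(-1)^j}{\Gamma(j-s)}\frac{d^j}{dx^j}\int_x^1\frac{v(y)}{(y-x)^{s-j+1}}dy.$$ Let ${}^+\mathcal F_N^{(-\alpha,\beta)}(\Lambda)=\{\phi=(1-x)^\alpha\psi:\psi\in\mathcal P_N\}$, and let $\Pi_N^{(0,\alpha+\beta)}:L^2_{\omega^{(0,\alpha+\beta)}}(\Lambda)\to\mathcal P_N$ be the orthogonal projection (note $\alpha+\beta>-1$). For $u$ with $D_+^\alpha u\in L^2_{\omega^{(0,\alpha+\beta)}}(\Lambda)$, ${}^+\pi_N^{(-\alpha,\beta)}u$ denotes the unique element of ${}^+\mathcal F_N^{(-\alpha,\beta)}(\Lambda)$ such that $$D_+^\alpha({}^+\pi_N^{(-\alpha,\beta)}u)=\Pi_N^{(0,\alpha+\beta)}(D_+^\alpha u).$$ *)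

(* Defs.v *)
From HB Require Import structures.
From mathcomp Require Import all_boot all_order all_algebra.
From mathcomp Require Import all_classical all_reals all_analysis.

Set Implicit Arguments.
Unset Strict Implicit.
Unset Printing Implicit Defensive.

Import Order.TTheory GRing.Theory Num.Theory.
Import numFieldNormedType.Exports.

Local Open Scope classical_set_scope.
Local Open Scope ring_scope.

Section GeneralizedJacobi.
Context {R : realType}.
Implicit Types (u v w f g F phi p : R -> R) (s a b alpha beta : R) (N n : nat).

Local Notation mu := (@lebesgue_measure R).

Definition Lambda : set R := `]-1, 1[.

Definition Gamma (z : R) : R :=
  \int[mu]_(t in `]0, +oo[) (t `^ (z - 1) * expR (- t)).

Definition jacobi_weight a b (x : R) : R := (1 - x) `^ a * (1 + x) `^ b.

Definition inner w u v : R := \int[mu]_(x in Lambda) (u x * v x * w x).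

Definition wnorm w u : R := Num.sqrt (inner w u u).

Definition in_L2 w u : Prop :=
  measurable_fun Lambda u /\
  mu.-integrable Lambda (fun x => (u x * u x * w x)%:E).

(* d^n/dx^n is understood in the sense of distributions on Lambda. An
   almost-everywhere pointwise derivative would not do: it would give singular
   functions, such as the Cantor function, the derivative 0. *)
Definition test_function phi : Prop :=
  (forall n (x : R), derivable (derive1n n phi) x 1) /\
  exists K : set R, [/\ compact K, K `<=` Lambda &
                        forall x, ~ K x -> phi x = 0].

Definition is_wderive n F g : Prop :=
  [/\ locally_integrable Lambda F, locally_integrable Lambda g &
      forall phi, test_function phi ->
        \int[mu]_(x in Lambda) (F x * derive1n n phi x) =
        (-1) ^+ n * \int[mu]_(x in Lambda) (g x * phi x)].

Definition wderivable n F : Prop := exists g, is_wderive n F g.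

(* One representative of the weak derivative, which is unique up to
   almost-everywhere equality on Lambda; meaningful when [wderivable n F]. *)
Definition wderive n F : R -> R := xget (cst 0) [set g | is_wderive n F g].

(* The integer j >= 1 with j - 1 <= s < j, for s >= 0. *)
Definition RL_index s : nat := (Num.truncn s).+1.

Definition RL_kernel s v (x y : R) : R :=
  v y / (y - x) `^ (s - (RL_index s)%:R + 1).

Definition RL_integral s v (x : R) : R :=
  \int[mu]_(y in `]x, 1[) RL_kernel s v x y.

Definition RL_derivable s v : Prop :=
  {ae mu, forall x, Lambda x ->
     mu.-integrable `]x, 1[ (fun y => (RL_kernel s v x y)%:E)} /\
  wderivable (RL_index s) (RL_integral s v).

(* The right Riemann-Liouville derivative D_+^s v; like [wderive], it is
   meaningful when [RL_derivable s v]. *)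
Definition RL_derive s v (x : R) : R :=
  (-1) ^+ RL_index s / Gamma ((RL_index s)%:R - s) *
  wderive (RL_index s) (RL_integral s v) x.

Definition RL_derive_in_L2 s w v : Prop :=
  RL_derivable s v /\ in_L2 w (RL_derive s v).

Definition polys N : set {poly R} := [set q | (size q <= N.+1)%N].

Definition Fplus alpha N : set (R -> R) :=
  [set p | exists2 q, polys N q & p = fun x => (1 - x) `^ alpha * q.[x]].

(* The L^2_w-orthogonal projection onto the polynomials of degree <= N,
   characterized by f - q being orthogonal to all of them. *)
Definition orth_proj w N f : {poly R} :=
  xget 0 [set q | polys N q /\
    forall r, polys N r -> inner w (fun x => f x - q.[x]) (horner r) = 0].

Definition plus_pi alpha beta N u : R -> R :=
  xget (cst 0) [set p | [/\ Fplus alpha N p, RL_derivable alpha p &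
    {ae mu, forall x, Lambda x -> RL_derive alpha p x =
       (orth_proj (jacobi_weight 0 (alpha + beta)) N (RL_derive alpha u)).[x]}]].

End GeneralizedJacobi.

(* Main.v *)
Require Import Defs.
From HB Require Import structures.
From mathcomp Require Import all_boot all_order all_algebra.
From mathcomp Require Import all_classical all_reals all_analysis.
From mathcomp Require Import measurable_realfun ring lra.

Set Implicit Arguments.
Unset Strict Implicit.
Unset Printing Implicit Defensive.

Import Order.TTheory GRing.Theory Num.Theory.
Import numFieldNormedType.Exports.

Local Open Scope classical_set_scope.
Local Open Scope ring_scope.

(** Write f = D_+^alpha u and gam = alpha + beta. The functions
    f_l = (-1)^l D_+^(alpha+l) u are the successive weak derivatives of f, and
    f minus its projection is orthogonal to the polynomials of degree at most N
    in L2(W(0,gam)), where W(a,b) = (1-x)^a (1+x)^b. Everything follows from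
    the sharp Poincare inequality: if f is orthogonal in L2(W(a,b)) to the
    polynomials of degree less than K, then
      K (K+a+b+1) |f|^2 <= |f'|^2,
    the right-hand norm being that of L2(W(a+1,b+1)). Integration by parts shows
    that f' is then orthogonal to the polynomials of degree less than K-1, so
    the inequality can be iterated m times from (a,b,K) = (0,gam,N+1), giving
    the factor prod_(i<m) (N+1-i)(N+2+gam+i).

    The Poincare inequality needs no expansion in Jacobi polynomials. Let L be
    the adjoint of d/dx, so that <p, L q>_(a,b) = <p', q>_(a+1,b+1). From
    (L q)' = L q' + (a+b+2) q one gets
      |L q|^2 = |q'|^2 + (a+b+2) |q|^2,
    and a polynomial p orthogonal to 1 has the form L q, where q inherits the
    orthogonality of p with one degree less. This gives the inequality for
    polynomials by induction on K, with the weight exponents raised by one at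
    each step, and it extends to f by density:
    |f|^2 is close to <f, L q> = <f', q>. *)

(** * Smooth functions *)

(** Applied to f minus its projection q, the iterated inequality bounds the error by |(f - q)^(m)|,
    not by |f^(m)|. But (f - q)^(m) is still orthogonal to the polynomials of degree at most N - m,
    among them q^(m), so Pythagoras gives |(f - q)^(m)| <= |f^(m)|. Since gam > -1, each factor
    N+2+gam+i exceeds N, so the product is at least N^m (N+1)!/(N-m+1)!, whose inverse square root
    is the stated constant. The obstacle is low regularity: weak derivatives are tested only against
    functions with compact support in the open interval, while the weights may be singular at the
    endpoints and f need not have boundary values. The adjointness of L and d/dx is therefore proved
    with explicit smooth cutoffs built from exp(-1/x). The Riemann-Liouville derivatives of orders
    alpha + l differentiate one and the same integral, which is what makes them consecutive weak
    derivatives up to sign. Projections and derivatives are picked by choice, hence the results on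
    existence and on uniqueness almost everywhere. *)

Section smooth.
Context {R : realType}.
Implicit Types (f g : R -> R) (U V : set R) (x y t : R) (n k : nat).

(** Differentiability n times at the points of [U], with no continuity asked of the last derivative;
    quantified over all n it means smoothness. *)
Fixpoint Cn n U f : Prop :=
  if n is m.+1 then (forall x, U x -> derivable f x 1) /\ Cn m U f^`()%classic
  else True.

Lemma Cn_sub n U V f : V `<=` U -> Cn n U f -> Cn n V f.
Proof.
by move=> VU; elim: n f => // n IH f /= [df Cf]; split => [x /VU|]; [exact: df|exact: IH].
Qed.

Lemma CnW n U f : Cn n.+1 U f -> Cn n U f.
Proof. by elim: n f => // n IH f [df Cf]; split => //; exact: IH. Qed.

Lemma open_eq_derive1 U f g x : open U -> (forall x, U x -> f x = g x) ->
  U x -> derivable f x 1 -> derivable g x 1 /\ g^`()%classic x = f^`()%classic x.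
Proof.
move=> oU fg Ux df.
have nfg : {near x, f =1 g}.
  by apply: filterS (open_nbhs_nbhs (conj oU Ux)) => y; exact: fg.
split; first exact: near_eq_derivable nfg df.
by rewrite !derive1E; apply/esym/near_eq_derive.
Qed.

Lemma Cn_eq n U f g : open U -> (forall x, U x -> f x = g x) -> Cn n U f -> Cn n U g.
Proof.
move=> oU; elim: n f g => // n IH f g fg [df Cf]; split => [x Ux|].
  by have [] := open_eq_derive1 oU fg Ux (df x Ux).
apply: IH Cf => x Ux.
by have [_ ->] := open_eq_derive1 oU fg Ux (df x Ux).
Qed.

Lemma Cn_derive n U f f' : open U -> (forall x, U x -> is_derive x 1 f (f' x)) ->
  Cn n U f' -> Cn n.+1 U f.
Proof.
move=> oU ff' Cf'; split=> [x /ff' //|].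
apply: Cn_eq Cf' => // x /ff' ?.
by rewrite derive1E derive_val.
Qed.

Lemma Cn_is_derive n U f x : Cn n.+1 U f -> U x -> is_derive x 1 f (f^`()%classic x).
Proof. by move=> [df _] /df; rewrite derive1E => /derivableP. Qed.

Lemma CnD n U f g : open U -> Cn n U f -> Cn n U g -> Cn n U (fun x => f x + g x).
Proof.
move=> oU; elim: n f g => // n IH f g Cf Cg.
apply: (Cn_derive (f' := fun x => f^`()%classic x + g^`()%classic x)) => //; last first.
  by apply: IH; [case: Cf|case: Cg].
by move=> x Ux; exact: (is_deriveD (Cn_is_derive Cf Ux) (Cn_is_derive Cg Ux)).
Qed.

Lemma CnM n U f g : open U -> Cn n U f -> Cn n U g -> Cn n U (fun x => f x * g x).
Proof.
move=> oU; elim: n f g => // n IH f g Cf Cg.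
apply: (Cn_derive (f' := fun x => f x * g^`()%classic x + g x * f^`()%classic x)) => //;
  last first.
  have [Cf' Cg'] := (CnW Cf, CnW Cg).
  by apply: CnD => //; apply: IH => //; [case: Cg|case: Cf].
by move=> x Ux; exact: (is_deriveM (Cn_is_derive Cf Ux) (Cn_is_derive Cg Ux)).
Qed.

Lemma Cn_comp n U V f g : open U -> (forall x, U x -> V (g x)) ->
  Cn n V f -> Cn n U g -> Cn n U (f \o g).
Proof.
move=> oU gUV; elim: n f => // n IH f Cf Cg.
apply: (@Cn_derive n U (f \o g) (fun x => g^`()%classic x * f^`()%classic (g x)));
  first exact: oU; last first.
  by apply: CnM => //; [case: Cg|apply: IH; [case: Cf|exact: CnW]].
move=> x Ux.
have dg := Cn_is_derive Cg Ux.
have df := Cn_is_derive Cf (gUV _ Ux).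
have := @is_derive1_comp _ f g x _ _ df dg.
by rewrite mulrC.
Qed.

Lemma Cn_cst n U c : Cn n U (cst c).
Proof.
elim: n c => // n IH c; split => [x _|]; first exact: derivable_cst.
rewrite (_ : (cst c)^`()%classic = cst 0) //.
by apply/funext => t; rewrite derive1_cst.
Qed.

Lemma Cn_horner n U (p : {poly R}) : Cn n U (horner p).
Proof.
elim: n p => // n IH p; split => [x _|]; first exact: derivable_horner.
by rewrite -derivE.
Qed.

Lemma Cn_powR n a : Cn n `]0, +oo[ (fun x => x `^ a).
Proof.
elim: n a => // n IH a.
apply: (Cn_derive (f' := fun x => a * x `^ (a - 1))) => //.
  by move=> x; rewrite /= in_itv/= andbT => x0; exact: is_derive1_powR.
apply: CnM => //; exact: Cn_cst.
Qed.

(* The linear span of this family is closed under differentiation, so that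
   exp(-1/x), extended by 0, is smooth. *)
Definition flat_exp k x : R := if 0 < x then x ^- k * expR (- x^-1) else 0.

Lemma flat_exp_gt0 k x : 0 < x -> flat_exp k x = x ^- k * expR (- x^-1).
Proof. by rewrite /flat_exp => ->. Qed.

Lemma flat_exp_le0 k x : x <= 0 -> flat_exp k x = 0.
Proof. by rewrite /flat_exp leNgt => /negbTE ->. Qed.

Lemma flat_exp_ge0 k x : 0 <= flat_exp k x.
Proof.
rewrite /flat_exp; case: ifP => // x0.
by rewrite mulr_ge0 ?expR_ge0// invr_ge0 exprn_ge0// ltW.
Qed.

(** Holds on the whole line, as both sides vanish for x <= 0. It serves both for the difference
    quotient at 0 and for trading a factor x against a lower index. *)
Lemma flat_expS k x : flat_exp k x = x * flat_exp k.+1 x.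
Proof.
have [x0|x0] := ltP 0 x; last by rewrite !flat_exp_le0 ?mulr0.
rewrite !flat_exp_gt0// exprS invfM !mulrA divff ?mul1r//.
by rewrite gt_eqF.
Qed.

(** One term of the exponential series suffices: (1/x)^k / k! <= exp(1/x). The factorial of k+1 is a
    coarser bound, uniform in the case k = 0. *)
Lemma flat_exp_le k x : flat_exp k x <= k.+1`!%:R.
Proof.
have [x0|x0] := ltP 0 x; last by rewrite flat_exp_le0.
rewrite flat_exp_gt0// expRN ler_pdivrMr ?expR_gt0//.
case: k => [|k].
  rewrite expr0 invr1 mul1r.
  by rewrite (le_trans _ (expR_ge1Dx _))// lerDl invr_ge0 ltW.
have := @expR_ge1Dxn _ (x^-1) k; rewrite invr_ge0 (ltW x0) => /(_ isT) h.
apply: (@le_trans _ _ (k.+1`!%:R * expR x^-1)); last first.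
  by rewrite ler_wpM2r ?expR_ge0// ler_nat factS leq_pmull.
rewrite mulrC -ler_pdivrMr ?ltr0n ?fact_gt0// -exprVn.
apply: le_trans h; rewrite lerDr ?ler01//.
Qed.

Lemma is_derive_flat_exp k x :
  is_derive x 1 (flat_exp k) (- k%:R * flat_exp k.+1 x + flat_exp k.+2 x).
Proof.
have [x0|x0|->] := ltgtP x 0.
- rewrite !flat_exp_le0 ?ltW// mulr0 addr0.
  apply: (near_eq_is_derive (f := cst 0)).
  near=> y; rewrite flat_exp_le0//.
  by apply/ltW; near: y; exact: lt_nbhsl.
- apply: (near_eq_is_derive (f := fun y => y ^- k * expR (- y^-1))).
    near=> y; rewrite flat_exp_gt0//.
    by near: y; exact: lt_nbhsr.
  have xn0 : x != 0 by rewrite gt_eqF.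
  have d1 : is_derive x 1 (fun y : R => y^-1) (- x ^- 2 *: 1).
    exact: (@is_deriveV _ id x 1 1).
  have d2 : is_derive x 1 (fun y : R => expR (- y^-1))
      (expR (- x^-1) * x ^- 2).
    apply: is_derive_eq.
    by rewrite /GRing.scale/= mulr1 opprK.
  have d3 : is_derive x 1 (fun y : R => y ^- k) (- k%:R * x ^- k.+1).
    have /derivableP := @exprn_derivable _ k x 1; rewrite -derive1E exp_derive1 => dX.
    have := @is_deriveV _ (fun y => y ^+ k) x _ 1 (expf_neq0 k xn0) dX.
    move=> /is_derive_eq; apply.
    have xk0 := expf_neq0 k xn0.
    rewrite /GRing.scale/=; case: k xk0 {dX} => [|k] xk0;
      first by rewrite !mul0r mulr0 oppr0 mul0r.
    rewrite !exprS in xk0 *; field.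
    by rewrite ?xn0 expf_neq0.
  have := is_deriveM d3 d2; move=> /is_derive_eq; apply.
  rewrite !flat_exp_gt0// /GRing.scale/= !exprS; field.
  by rewrite ?xn0 expf_neq0.
- rewrite !flat_exp_le0// mulr0 addr0.
  (* By [flat_expS] the difference quotient at 0 is exactly [flat_exp k.+1]; the same identity
     bounds it by |y| times a constant, so it is continuous at 0 with value 0. *)
  apply/is_derive1_caratheodory; exists (flat_exp k.+1); split.
  + by move=> z; rewrite (flat_exp_le0 _ (lexx 0)) !subr0 mulrC -flat_expS.
  + rewrite /prop_for /continuous_at (flat_exp_le0 _ (lexx 0)).
    have H (e : R) : 0 < e -> \forall y \near (0 : R), `|y| <= e.
      by move=> e0; apply: nbhs0_le.
    apply/cvgrPdist_le => e e0; near=> y.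
    rewrite sub0r normrN flat_expS normrM (ger0_norm (flat_exp_ge0 _ _)).
    apply: (@le_trans _ _ (`|y| * k.+3`!%:R)).
      by rewrite ler_wpM2l// flat_exp_le.
    rewrite -ler_pdivlMr ?ltr0n ?fact_gt0//.
    by near: y; apply: H; rewrite divr_gt0// ltr0n fact_gt0.
  + by rewrite flat_exp_le0.
Unshelve. all: by end_near. Qed.

Lemma Cn_flat_exp n U k : open U -> Cn n U (flat_exp k).
Proof.
move=> oU; elim: n k => // n IH k.
apply: (Cn_derive (f' := fun x => - k%:R * flat_exp k.+1 x + flat_exp k.+2 x)) => //.
  by move=> x _; exact: is_derive_flat_exp.
by apply: CnD => //; apply: CnM => //; exact: Cn_cst.
Qed.

End smooth.

(** * Test functions *)

Section test_functions.
Context {R : realType}.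
Implicit Types (f g phi : R -> R) (U V K : set R) (c d x y t : R) (n k : nat).
Local Notation mu := (@lebesgue_measure R).
Local Notation Lambda := (@Lambda R).

Lemma CnU n U V f : Cn n U f -> Cn n V f -> Cn n (U `|` V) f.
Proof.
elim: n f => // n IH f [dU CU] [dV CV]; split; last exact: IH.
by move=> x [/dU|/dV].
Qed.

Lemma open_Lambda : open Lambda. Proof. exact: interval_open. Qed.

Lemma measurable_Lambda : measurable (Lambda : set (measurableTypeR R)). Proof. exact:
  measurable_itv. Qed.
Hint Resolve measurable_Lambda : core.

Lemma measurable_itvR (i : interval R) : measurable ([set` i] : set (measurableTypeR R)).
Proof. exact: measurable_itv. Qed.


Lemma LambdaP x : Lambda x <-> -1 < x < 1.
Proof. by rewrite /Lambda/= in_itv. Qed.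

Lemma open_compactC K : compact K -> open (~` K).
Proof. by move=> cK; apply: closed_openC; apply: compact_closed cK; exact: norm_hausdorff. Qed.

Lemma test_functionP phi : test_function phi <->
  (forall n, Cn n setT phi) /\ exists K, [/\ compact K, K `<=` Lambda &
     forall x, ~ K x -> phi x = 0].
Proof.
split=> [[df K]|[Cphi K]]; split => //.
  move=> n; elim: n phi df {K} => // n IH phi df; split => [x _|].
    exact: (df 0%N).
  by apply: IH => m x; rewrite -derive1Sn; exact: df.
move=> n; elim: n phi Cphi {K} => [|n IH] phi Cphi x.
  by have [+ _] := Cphi 1%N; apply.
rewrite derive1Sn; apply: IH => m.
by have [_] := Cphi m.+1.
Qed.

Lemma test_function_derive phi : test_function phi -> test_function phi^`()%classic.
Proof.
move=> /test_functionP[Cphi [K [cK KL phi0]]]; apply/test_functionP; split.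
  by move=> n; have [] := Cphi n.+1.
exists K; split => // x Kx.
have oK := open_compactC cK.
have [_ ->] := @open_eq_derive1 _ (~` K) (cst 0) phi x oK
  (fun y Ky => esym (phi0 y Ky)) Kx (derivable_cst _ _ _).
by rewrite derive1_cst.
Qed.

Lemma test_function_deriven n phi : test_function phi -> test_function (derive1n n phi).
Proof.
by elim: n => // n IH tphi; rewrite derive1nS; apply/test_function_derive/IH.
Qed.

Lemma test_function_derivable phi x : test_function phi -> derivable phi x 1.
Proof. by move=> /test_functionP[/(_ 1%N)[+ _] _]; apply. Qed.

Lemma test_function_continuous phi : test_function phi -> continuous phi.
Proof.
move=> tphi x; apply/differentiable_continuous/derivable1_diffP.
exact: test_function_derivable.
Qed.

(** Two open sets cover the line: [Lambda], where both factors are smooth, and the complement of the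
    compact set, where the product is 0. So g may be singular at the endpoints, as Jacobi weights
    are. *)
Lemma test_functionM phi g : test_function phi -> (forall n, Cn n Lambda g) ->
  test_function (fun x => phi x * g x).
Proof.
move=> /test_functionP[Cphi [K [cK KL phi0]]] Cg; apply/test_functionP; split.
  move=> n.
  have oK := open_compactC cK.
  have -> : setT = Lambda `|` ~` K.
    apply/seteqP; split => // x _.
    by have [/KL|] := pselect (K x); [left|right].
  apply: CnU.
    apply: CnM; [exact: open_Lambda| |exact: Cg].
    exact: Cn_sub (Cphi n).
  apply: (@Cn_eq _ _ _ (cst 0)); [exact: oK| |exact: Cn_cst].
  by move=> x Kx; rewrite phi0// mul0r.
by exists K; split => // x Kx; rewrite phi0// mul0r.
Qed.

(** * Cutoffs and bumps: [flat_exp 0] of a polynomial *)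

Definition flat_poly (p : {poly R}) x := flat_exp 0 p.[x].

Lemma Cn_flat_poly n p : Cn n setT (flat_poly p).
Proof.
apply: (@Cn_comp _ _ _ setT); [exact: openT|by []| |exact: Cn_horner].
by apply: Cn_flat_exp; exact: openT.
Qed.

Lemma flat_poly_le0 (p : {poly R}) x : p.[x] <= 0 -> flat_poly p x = 0.
Proof. exact: flat_exp_le0. Qed.

(** The term -1 keeps the support inside the region 1 - x^2 >= 1/n, away from the endpoints.
    Proportionality of the rest to 1 - x^2 is what later controls the derivative of the cutoff
    uniformly in n. *)
Definition cutoff_poly n : {poly R} := (n%:R *: (1 - 'X^2) - 1).

Lemma cutoff_polyE n x : (cutoff_poly n).[x] = n%:R * (1 - x ^+ 2) - 1.
Proof. by rewrite /cutoff_poly !hornerE. Qed.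

Definition cutoff n := flat_poly (cutoff_poly n).

Lemma test_function_cutoff n : test_function (cutoff n).
Proof.
apply/test_functionP; split; first by move=> k; exact: Cn_flat_poly.
have [e0 e1] : 0 < n.+1%:R^-1 :> R /\ n.+1%:R^-1 <= 1 :> R.
  by rewrite invr_gt0 ltr0n invf_le1// ler1n.
pose e : R := n.+1%:R^-1; rewrite -/e in e0 e1.
(* With e = 1/(n+1), 1 - r^2 = e - e^2/4 <= e. Hence |x| > r forces n (1 - x^2) <= 1, also when n =
   0. *)
pose r : R := 1 - e / 2.
exists `[- r, r]%classic; split; first exact: segment_compact.
  move=> x; rewrite /Lambda/= !in_itv/= /r => /andP[h1 h2].
  by apply/andP; split; lra.
move=> x; rewrite /= in_itv/= => /negP xr; apply: flat_poly_le0.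
rewrite cutoff_polyE subr_le0.
have [x1|x1] := leP 1 (x ^+ 2).
  by rewrite (le_trans _ (@ler01 R))// mulr_ge0_le0// subr_le0.
have : 1 - x ^+ 2 <= e.
  have rr : 1 - r ^+ 2 <= e by rewrite /r; nra.
  apply: le_trans rr; rewrite lerD2l lerN2.
  rewrite -[leRHS]real_normK ?num_real//.
  have r0 : 0 <= r by rewrite /r; lra.
  rewrite lerXn2r ?nnegrE// ltW// ltNge; apply/negP => h.
  by move: xr; rewrite -ler_norml h.
move=> /(ler_wpM2l (ler0n R n.+1)); rewrite divff// => h.
apply: le_trans h; rewrite ler_wpM2r ?ler_nat// subr_ge0.
exact: ltW.
Qed.

(** Unlike for the cutoffs, the support stays in [c, d] for every n, and the limit is the indicator
    of ]c, d[. *)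
Definition flat_bump_poly c d n : {poly R} := n%:R *: (('X - c%:P) * (d%:P - 'X)).

Lemma flat_bump_polyE c d n x : (flat_bump_poly c d n).[x] = n%:R * ((x - c) * (d - x)).
Proof. by rewrite /flat_bump_poly !hornerE. Qed.

Definition flat_bump c d n := flat_poly (flat_bump_poly c d n).

Lemma flat_bump_out c d n x : c < d -> ~ `[c, d]%classic x -> flat_bump c d n x = 0.
Proof.
move=> cd xcd; apply: flat_poly_le0; rewrite flat_bump_polyE mulr_ge0_le0//.
move: xcd; rewrite /= in_itv/= => /negP; rewrite negb_and -!ltNge => /orP[h|h].
  by rewrite mulr_le0_ge0//; lra.
by rewrite mulr_ge0_le0//; lra.
Qed.

Lemma test_function_flat_bump c d n : -1 < c -> c < d -> d < 1 ->
  test_function (flat_bump c d n).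
Proof.
move=> c1 cd d1; apply/test_functionP; split; first by move=> k; exact: Cn_flat_poly.
exists `[c, d]%classic; split; first exact: segment_compact.
  move=> x; rewrite /Lambda/= !in_itv/= => /andP[h1 h2].
  by apply/andP; split; lra.
by move=> x; exact: flat_bump_out.
Qed.

Lemma flat_exp01 x : 0 <= flat_exp 0 x <= 1.
Proof. by rewrite flat_exp_ge0/= flat_exp_le. Qed.

Lemma cvg_invr_pinfty : x^-1 @[x --> +oo] --> (0 : R).
Proof. by apply/(@gtr0_cvgV0 _ _ _ _ id); [exact: nbhs_pinfty_gt|exact: cvg_id]. Qed.

Lemma cvg_flat_exp0 : flat_exp 0 x @[x --> +oo] --> (1 : R).
Proof.
have H : expR (- x^-1) @[x --> +oo] --> (1 : R).
  rewrite -[X in _ --> X]expR0; apply: continuous_cvg; first exact: continuous_expR.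
  rewrite -[X in _ --> X]oppr0; exact: cvgN cvg_invr_pinfty.
apply: cvg_trans H; apply: near_eq_cvg; near=> x.
rewrite flat_exp_gt0 ?expr0 ?invr1 ?mul1r//.
Unshelve. all: by end_near. Qed.

Lemma cvg_natM_pinfty (a b : R) : 0 < a -> n%:R * a + b @[n --> \oo] --> +oo.
Proof.
move=> a0; apply/cvgryPge => A; near=> n.
rewrite -lerBlDr -ler_pdivrMr//.
by near: n; exact: nbhs_infty_ger.
Unshelve. all: by end_near. Qed.

Lemma cvg_cutoff x : Lambda x -> cutoff n x @[n --> \oo] --> (1 : R).
Proof.
move=> /LambdaP /andP[x1 x2].
rewrite /cutoff /flat_poly; under eq_fun do rewrite cutoff_polyE.
apply: cvg_comp cvg_flat_exp0; apply: cvg_natM_pinfty; nra.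
Qed.

Lemma cvg_flat_bump c d x : c < x < d -> flat_bump c d n x @[n --> \oo] --> (1 : R).
Proof.
move=> /andP[cx xd]; rewrite /flat_bump /flat_poly; under eq_fun do rewrite flat_bump_polyE.
under eq_fun do rewrite -[_ * _]addr0.
by apply: cvg_comp cvg_flat_exp0; apply: cvg_natM_pinfty; rewrite mulr_gt0// subr_gt0.
Qed.

End test_functions.
#[global] Hint Resolve measurable_Lambda : core.

(** * Integrability of Jacobi weights and of the Gamma integrand *)

Section integrals.
Context {R : realType}.
Implicit Types (f g : R -> R) (D : set R) (a b c d x y t z : R) (n k : nat).
Local Notation mu := (@lebesgue_measure R).
Local Notation Lambda := (@Lambda R).

(** * Affine change of variables *)

Lemma measurable_affine a b : measurable_fun setT (fun x : R => a * x + b).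
Proof. by apply: measurable_funD => //; exact: measurable_funM. Qed.

(** By uniqueness of the Lebesgue measure, the scaled pushforward need only be compared with it on
    half-open intervals. A negative [a] reverses them, whence the two cases. *)
Lemma lebesgue_measure_affine a b (A : set R) : a != 0 -> measurable A ->
  mu A = (`|a|%:E * mu ((fun x => a * x + b)%R @^-1` A))%E.
Proof.
move=> a0 mA.
pose phi : measurableTypeR R -> measurableTypeR R := fun x => a * x + b.
have mphi : measurable_fun setT phi by exact: measurable_affine.
pose pf : {measure set (measurableTypeR R) -> \bar R} :=
  measure_function_pushforward__canonical__measure_function_Measure mu mphi.
pose nu : {measure set (measurableTypeR R) -> \bar R} :=
  mscale (NngNum (normr_ge0 a)) pf.
apply: (@lebesgue_measure_unique R nu _ A mA) => _ [[c d] _ <-] /=.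
rewrite /nu /= /mscale /= /pushforward /phi.
have [cd|dc] := ltP c d; last first.
  rewrite set_itv_ge -?leNgt ?bnd_simp// preimage_set0 !measure0 mule0//.
have [a_gt0|a_lt0] : 0 < a \/ a < 0 by case: (ltgtP a 0) a0 => //; [right|left].
  have -> : (fun x => a * x + b) @^-1` `]c, d] = `](c - b) / a, (d - b) / a]%classic.
    apply/seteqP; split => x /=; rewrite !in_itv/= ltr_pdivrMr// ler_pdivlMr// mulrC.
      by move=> /andP[? ?]; apply/andP; split; lra.
    by move=> /andP[? ?]; apply/andP; split; lra.
  rewrite !lebesgue_measure_itv/= !lte_fin cd ltr_pM2r ?invr_gt0// ltrD2r cd.
  rewrite -!EFinD -EFinM gtr0_norm//; congr EFin; field.
  by rewrite gt_eqF.
have -> : (fun x => a * x + b) @^-1` `]c, d] = `[(d - b) / a, (c - b) / a[%classic.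
  apply/seteqP; split => x /=; rewrite !in_itv/= ltr_ndivlMr// ler_ndivrMr// mulrC.
    by move=> /andP[? ?]; apply/andP; split; lra.
  by move=> /andP[? ?]; apply/andP; split; lra.
rewrite !lebesgue_measure_itv/= !lte_fin cd ltr_nM2r ?invr_lt0// ltrD2r cd.
rewrite -!EFinD -EFinM ltr0_norm//; congr EFin; field.
by rewrite lt_eqF.
Qed.

Lemma ge0_integral_affine a b D (f : R -> \bar R) : a != 0 -> measurable D ->
  measurable_fun D f -> {in D, forall x, 0 <= f x}%E ->
  (\int[mu]_(x in D) f x =
   `|a|%:E * \int[mu]_(t in (fun t => a * t + b)%R @^-1` D) f (a * t + b)%R)%E.
Proof.
move=> a0 mD mf f0.
pose phi : measurableTypeR R -> measurableTypeR R := fun x => a * x + b.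
have mphi : measurable_fun setT phi by exact: measurable_affine.
rewrite -[X in (_ * X)%E](@ge0_integral_pushforward _ _ _ _ _ phi mphi mu D f)//.
pose pf : {measure set (measurableTypeR R) -> \bar R} :=
  measure_function_pushforward__canonical__measure_function_Measure mu mphi.
rewrite -(@ge0_integral_mscale _ _ _ pf D mD (NngNum (normr_ge0 a)) f)//.
  apply: eq_measure_integral => A mA _.
  first [exact: (lebesgue_measure_affine b a0 mA) | exact: (esym (lebesgue_measure_affine b
    a0 mA))].
by move=> x Dx; apply: f0; rewrite inE.
Qed.

Lemma Rintegral_gt0 D f : measurable D -> (0 < mu D)%E -> mu.-integrable D (EFin \o f) ->
  (forall x, D x -> 0 < f x) -> 0 < \int[mu]_(x in D) f x.
Proof.
move=> mD D0 intf f0.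
have ge0 : 0 <= \int[mu]_(x in D) f x by apply: Rintegral_ge0 => x /f0/ltW.
rewrite lt_neqAle ge0 andbT; apply/eqP => /esym If0.
have If : (\int[mu]_(x in D) `|(EFin \o f) x| = 0)%E.
  transitivity (\int[mu]_(x in D) (f x)%:E)%E.
    by apply: eq_integral => x; rewrite inE => /f0 fx; rewrite /= gtr0_norm.
  rewrite -(@fineK _ (\int[mu]_(x in D) (f x)%:E)%E); last exact: integrable_fin_num.
  by rewrite [fine _]If0.
have mf := measurable_int _ intf.
have /(ae_eq_integral_abs mu mD mf) [N [mN N0 DN]] := If.
have : (mu D <= mu N)%E.
  apply: le_measure; rewrite ?inE// => x Dx; apply: DN => /(_ Dx)/= /eqP.
  by rewrite eqe gt_eqF// f0.
by rewrite N0 leNgt D0.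
Qed.

(** On the intervals [1/(i+2), 1] the primitive t^(z+1)/(z+1) bounds the integral by 1/(z+1),
    uniformly in i; monotone convergence does the rest. The shift by 2 keeps the left end below
    1. *)
Lemma integrable_powR01 z : -1 < z -> mu.-integrable `]0, 1[ (fun t => (t `^ z)%:E).
Proof.
move=> z1; have z10 : 0 < z + 1 by lra.
have mp (D : set R) : measurable_fun D (fun t => (t `^ z)%:E).
  apply/measurable_EFinP/measurable_funTS; exact: measurable_powR.
apply/integrableP; split; first exact: mp.
pose F i : set R := `[i.+2%:R^-1, 1]%classic.
have F0 i : 0 < i.+2%:R^-1 :> R by rewrite invr_gt0.
have F1 i : i.+2%:R^-1 < 1 :> R by rewrite invf_lt1// ltr1n.
under eq_integral do rewrite gee0_abs ?lee_fin ?powR_ge0//.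
have IF i : (\int[mu]_(t in F i) (t `^ z)%:E <= ((z + 1)^-1)%:E)%E.
  have d x : 0 < x -> is_derive x 1 (fun t => (z + 1)^-1 * t `^ (z + 1)) (x `^ z).
    move=> x0; have := is_derive1_powR (z + 1) x0 => h.
    apply: is_derive_eq; rewrite /GRing.scale/= addrK mulrA mulVf ?mul1r// gt_eqF//.
  have c x : 0 < x -> {for x, continuous (fun t => (z + 1)^-1 * t `^ (z + 1))}.
    by move=> /d dx; apply/differentiable_continuous/derivable1_diffP.
  rewrite /F (@continuous_FTC2 _ _ (fun t => (z + 1)^-1 * t `^ (z + 1)) _ _ (F1 i)).
  - by rewrite powR1 mulr1 -EFinB lee_fin gerBl mulr_ge0 ?powR_ge0// invr_ge0 ltW.
  - apply: derivable_within_continuous => x; rewrite in_itv/= => /andP[x0 _].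
    by apply: derivable_powR; rewrite in_itv/= andbT (lt_le_trans (F0 i)).
  - split.
    + by move=> x; rewrite in_itv/= => /andP[x0 _]; have := d x (lt_trans (F0 i) x0).
    + by apply: cvg_at_right_filter; exact: c.
    + by apply: cvg_at_left_filter; exact: c.
  - move=> x; rewrite in_itv/= => /andP[x0 _]; rewrite derive1E.
    by have := d x (lt_trans (F0 i) x0) => h; rewrite derive_val.
have ndF : {homo F : n m / (n <= m)%N >-> (n <= m)%O}.
  move=> n m nm; apply/subsetPset => x; rewrite /F/= !in_itv/= => /andP[h ->].
  by rewrite andbT (le_trans _ h)// lef_pV2 ?posrE// ler_nat.
have cvgF := @ge0_nondecreasing_set_cvg_integral _ (measurableTypeR R) R F (fun t =>
  (t `^ z)%:E)
  lebesgue_measure ndF (fun=> measurable_itv _) (fun=> mp _)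
  (fun i x _ => powR_ge0 x z).
apply: (@le_lt_trans _ _ (\int[mu]_(x in \bigcup_i F i) (x `^ z)%:E)%E).
  apply: ge0_subset_integral => //.
  - by apply: bigcup_measurable => k _; exact: measurable_itv.
  - exact: mp.
  - by move=> x _; rewrite lee_fin powR_ge0.
  - move=> x; rewrite /= in_itv/= => /andP[x0 x1].
    have [k /= _ kx] := near_infty_natSinv_lt (PosNum x0).
    exists k => //; rewrite /F/= in_itv/= (ltW x1) andbT.
    apply: le_trans (ltW (kx k (leqnn k))).
    by rewrite lef_pV2 ?posrE// ler_nat.
rewrite -(cvg_lim _ cvgF)//.
apply: (@le_lt_trans _ _ ((z + 1)^-1)%:E); last by rewrite ltry.
apply: lime_le; first by apply/cvg_ex; eexists; exact: cvgF.
by apply: nearW => i; exact: IF.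
Qed.

(** At x = a t + b the base is |a| t. The sign of [a] selects the endpoint at which the power is
    singular: it is p for a = q - p and q for a = p - q. *)
Lemma integrable_powR_affine a b p q z : a != 0 -> -1 < z ->
  (fun t => a * t + b) @^-1` `]p, q[ = `]0, 1[%classic ->
  mu.-integrable `]p, q[ (fun x => ((`|a| * ((x - b) / a)) `^ z)%:E).
Proof.
move=> a0 z1 DE.
have mD : measurable (`]p, q[%classic : set R) by exact: measurable_itv.
have mf : measurable_fun `]p, q[ (fun x => ((`|a| * ((x - b) / a)) `^ z)%:E).
  apply/measurable_EFinP/measurable_funTS.
  apply: (measurableT_comp (measurable_powR z)).
  apply: measurable_funM => //; apply: measurable_funM => //.
  exact: measurable_funB.
apply/integrableP; split => //.
rewrite (ge0_integral_affine b a0 mD) ?DE; last 2 first.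
- exact: measurableT_comp.
- by move=> x _; exact: abse_ge0.
rewrite lte_mul_pinfty//.
have /(integrableZl _ (`|a| `^ z)) := integrable_powR01 z1.
move=> /(_ (measurable_itv _)) /integrableP[_]; apply: le_lt_trans.
rewrite le_eqVlt; apply/orP; left; apply/eqP; apply: eq_integral => x;
  rewrite inE/= in_itv/= => /andP[x0 x1].
by rewrite addrK mulrAC divff// mul1r powRM// ltW.
Qed.

Lemma integrable_powR_subl p q z : p < q -> -1 < z ->
  mu.-integrable `]p, q[ (fun x => ((x - p) `^ z)%:E).
Proof.
move=> pq z1; have d0 : 0 < q - p by rewrite subr_gt0.
have DE : (fun t => (q - p) * t + p) @^-1` `]p, q[ = `]0, 1[%classic.
  apply/seteqP; split => x; rewrite /= !in_itv/= => /andP[h1 h2].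
    by apply/andP; split; nra.
  by apply/andP; split; nra.
move: (integrable_powR_affine (lt0r_neq0 d0) z1 DE); apply: eq_integrable => //.
by move=> x _; rewrite gtr0_norm// mulrCA divff ?mulr1// gt_eqF.
Qed.

Lemma integrable_powR_subr p q z : p < q -> -1 < z ->
  mu.-integrable `]p, q[ (fun x => ((q - x) `^ z)%:E).
Proof.
move=> pq z1; have d0 : p - q < 0 by rewrite subr_lt0.
have DE : (fun t => (p - q) * t + q) @^-1` `]p, q[ = `]0, 1[%classic.
  apply/seteqP; split => x; rewrite /= !in_itv/= => /andP[h1 h2].
    by apply/andP; split; nra.
  by apply/andP; split; nra.
move: (integrable_powR_affine (ltr0_neq0 d0) z1 DE); apply: eq_integrable => //.
by move=> x _; rewrite ltr0_norm// mulrCA mulNr divff ?lt_eqF//; congr (_ `^ _)%:E; ring.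
Qed.

(** * Integrability of Jacobi weights *)

Lemma measurable_weight a b (D : set R) : measurable_fun D (jacobi_weight a b : R -> R).
Proof.
apply: measurable_funTS; apply: measurable_funM.
- apply: (measurableT_comp (measurable_powR a)); exact: measurable_funB.
- apply: (measurableT_comp (measurable_powR b)); exact: measurable_funD.
Qed.

Lemma weight_gt0 a b x : Lambda x -> 0 < jacobi_weight a b x.
Proof.
move=> /LambdaP/andP[x1 x2]; rewrite mulr_gt0// powR_gt0; lra.
Qed.

Lemma weight_ge0 a b x : 0 <= jacobi_weight a b x.
Proof. by rewrite mulr_ge0 ?powR_ge0. Qed.

Lemma powR_le12 a x : 1 <= x <= 2 -> x `^ a <= 1 + 2 `^ a.
Proof.
move=> /andP[x1 x2]; have x0 : 0 < x by lra.
have [a0|a0] := leP 0 a.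
  apply: (@le_trans _ _ (2 `^ a)); last by rewrite lerDr.
  by rewrite ge0_ler_powR ?nnegrE//; lra.
apply: (@le_trans _ _ 1); last by rewrite lerDl powR_ge0.
by rewrite -[leRHS](powRr0 x) ler_powR// ltW.
Qed.

(** On each half of [Lambda] one of the two factors has its base in [1, 2] and is bounded; the other
    is an integrable power. *)
Lemma integrable_weight a b : -1 < a -> -1 < b ->
  mu.-integrable Lambda (EFin \o (jacobi_weight a b : R -> R)).
Proof.
move=> a1 b1.
have m11 : -1 < 1 :> R by lra.
have Ia := integrableZl measurable_Lambda (1 + 2 `^ b) (integrable_powR_subr m11 a1).
have Ib := integrableZl measurable_Lambda (1 + 2 `^ a) (integrable_powR_subl m11 b1).
have := integrableD measurable_Lambda Ia Ib.
apply: le_integrable => //.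
  by apply/measurable_EFinP; exact: measurable_weight.
move=> x /LambdaP/andP[x1 x2].
have pa := powR_ge0 2 a; have pb := powR_ge0 2 b.
have pxa := powR_ge0 (1 - x) a; have pxb := powR_ge0 (1 + x) b.
rewrite /= lee_fin opprK [x + 1]addrC.
rewrite !ger0_norm ?weight_ge0// ?addr_ge0 ?mulr_ge0 ?addr_ge0//.
rewrite /jacobi_weight; have [x0|x0] := leP 0 x.
  have : (1 + x) `^ b <= 1 + 2 `^ b by apply: powR_le12; lra.
  nra.
have : (1 - x) `^ a <= 1 + 2 `^ a by apply: powR_le12; lra.
nra.
Qed.

Lemma integrableU (A B : set (measurableTypeR R)) (f : R -> \bar R) :
  measurable A -> measurable B -> [disjoint A & B] ->
  mu.-integrable A f -> mu.-integrable B f -> mu.-integrable (A `|` B) f.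
Proof.
move=> mA mB AB /integrableP[mfA IA] /integrableP[mfB IB].
have mf : measurable_fun (A `|` B) f by apply/measurable_funU.
apply/integrableP; split => //.
rewrite integral_setU//; last exact: measurableT_comp.
exact: lte_add_pinfty.
Qed.

(** The arguments that occur are j - s with j the index of s, and lie in ]0, 1]. There t^(z-1)
    dominates on ]0, 1[ and exp(-t) on [1, +oo[. *)
Lemma integrable_Gamma z : 0 < z <= 1 ->
  mu.-integrable `]0, +oo[ (fun t => (t `^ (z - 1) * expR (- t))%:E).
Proof.
move=> /andP[z0 z1].
have m D : measurable_fun D (fun t : R => t `^ (z - 1) * expR (- t)).
  apply: measurable_funTS; apply: measurable_funM; first exact: measurable_powR.
  by apply: (measurableT_comp (@measurable_expR R)); exact: oppr_measurable.
have -> : `]0, +oo[%classic = `]0, 1[%classic `|` `[1, +oo[%classic :> set R.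
  apply/seteqP; split => x /=; rewrite !in_itv/= !andbT.
    by move=> x0; have [x1|x1] := ltP x 1; [left; rewrite x0|right].
  by move=> [/andP[]//|x1]; exact: lt_le_trans x1.
apply: integrableU; [exact: measurable_itv|exact: measurable_itv| | |]; last 2 first.
- have z11 : -1 < z - 1 by lra.
  have := integrable_powR01 z11; apply: le_integrable => //.
    by apply/measurable_EFinP; exact: m.
  move=> t; rewrite /= in_itv/= => /andP[t0 t1].
  rewrite lee_fin !ger0_norm ?mulr_ge0 ?powR_ge0 ?expR_ge0//.
  by rewrite ler_piMr ?powR_ge0// -[leRHS]expR0 ler_expR oppr_le0 ltW.
- have : mu.-integrable `[1, +oo[ (EFin \o (fun t => expR (- t))).
    apply/integrableP; split.
      apply/measurable_EFinP/measurable_funTS.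
      by apply: (measurableT_comp (@measurable_expR R)); exact: oppr_measurable.
    under eq_integral do rewrite /= gtr0_norm ?expR_gt0//.
    rewrite (@ge0_continuous_FTC2y _ _ (fun t => - expR (- t)) _ 0)//.
    + by rewrite -EFinB ltry.
    + apply: continuous_subspaceT => x; apply: continuous_comp; first exact: continuousN.
      exact: continuous_expR.
    + rewrite -[X in _ --> X]oppr0; apply: cvgN.
      exact: cvgr_expR.
    + by apply: cvg_at_right_filter; apply: cvgN; apply: continuous_comp;
        [exact: continuousN|exact: continuous_expR].
    + move=> x _; rewrite derive1E derive_val; ring.
  apply: le_integrable => //; first by apply/measurable_EFinP; exact: m.
  move=> t; rewrite /= in_itv/= andbT => t1.
  rewrite lee_fin !ger0_norm ?mulr_ge0 ?powR_ge0 ?expR_ge0//.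
  by rewrite ler_piMl ?expR_ge0// -[leRHS](powRr0 t) ler_powR// subr_le0.
- apply/disj_setPS => x [] /=.
  rewrite !in_itv/= andbT => /andP[_ x1] x1'; lra.
Qed.

Lemma Gamma_gt0 z : 0 < z <= 1 -> 0 < Gamma z.
Proof.
move=> z01; apply: Rintegral_gt0 => //; last 2 first.
- exact: integrable_Gamma.
- by move=> x; rewrite /= in_itv/= andbT => x0; rewrite mulr_gt0 ?expR_gt0 ?powR_gt0.
- by rewrite lebesgue_measure_itv/= ltry oppr0 adde0 ltry.
Qed.

End integrals.

(** * Riemann-Liouville integrals of (1 - x)^alpha times a polynomial *)

Section RL_poly.
Context {R : realType}.
Implicit Types (f g : R -> R) (D : set R) (a b c d x y t z s A : R) (n k : nat).
Local Notation mu := (@lebesgue_measure R).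
Local Notation Lambda := (@Lambda R).


(** Euler's beta function B(A + 1, 1 - s). *)
Definition RL_beta A s : R := \int[mu]_(t in `]0, 1[) ((1 - t) `^ A / t `^ s).

Lemma measurable_RL_beta A s x (D : set R) :
  measurable_fun D (fun y : R => (1 - y) `^ A / (y - x) `^ s).
Proof.
apply: measurable_funTS; under eq_fun do rewrite -powRN.
apply: measurable_funM.
- by apply: (measurableT_comp (measurable_powR A)); exact: measurable_funB.
- by apply: (measurableT_comp (measurable_powR (- s))); exact: measurable_funB.
Qed.

Lemma integrable_RL_beta A s x : 0 <= A -> s < 1 -> x < 1 ->
  mu.-integrable `]x, 1[ (fun y => ((1 - y) `^ A / (y - x) `^ s)%:E).
Proof.
move=> A0 s1 x1; have s1' : -1 < - s by lra.
have := integrable_powR_subl x1 s1' => /(integrableZl _ ((1 - x) `^ A)).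
move=> /(_ (measurable_itvR _)); apply: le_integrable => //.
  by apply/measurable_EFinP; exact: measurable_RL_beta.
move=> y; rewrite /= in_itv/= => /andP[xy y1].
rewrite lee_fin -powRN !ger0_norm ?mulr_ge0 ?powR_ge0//.
by rewrite ler_wpM2r ?powR_ge0// ge0_ler_powR ?nnegrE//; lra.
Qed.

Lemma RL_beta_gt0 A s : 0 <= A -> s < 1 -> 0 < RL_beta A s.
Proof.
move=> A0 s1; apply: Rintegral_gt0 => //.
- by rewrite lebesgue_measure_itv/= lte_fin ltr01 -EFinB lte_fin subr0.
- have := integrable_RL_beta A0 s1 ltr01; apply: eq_integrable => // y _ /=.
  by rewrite subr0.
- move=> t; rewrite /= in_itv/= => /andP[t0 t1].
  by rewrite divr_gt0// powR_gt0// subr_gt0.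
Qed.

(** Under y = x + (1 - x) t the two bases become (1 - x)(1 - t) and (1 - x) t, so that all of the
    dependence on x factors out. *)
Lemma RL_beta_affine A s x : 0 <= A -> s < 1 -> x < 1 ->
  \int[mu]_(y in `]x, 1[) ((1 - y) `^ A / (y - x) `^ s) =
  RL_beta A s * (1 - x) `^ (A + (1 - s)).
Proof.
move=> A0 s1 x1; have d0 : 0 < 1 - x by lra.
rewrite /RL_beta /Rintegral (@ge0_integral_affine _ (1 - x) x)//.
- have -> : (fun t => (1 - x) * t + x) @^-1` `]x, 1[ = `]0, 1[%classic.
    by apply/seteqP; split => t; rewrite /= !in_itv/= => /andP[h1 h2]; apply/andP; split; nra.
  rewrite (_ : \int[_]_(_ in _) _ = \int[mu]_(t in `]0%R, 1%R[)
     (((1 - x) `^ (A - s))%:E * ((1 - t) `^ A / t `^ s)%:E))%E; last first.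
    apply: eq_integral => t; rewrite inE/= in_itv/= => /andP[t0 t1].
    rewrite -EFinM addrK; congr EFin.
    rewrite (_ : 1 - _ = (1 - x) * (1 - t)); last by ring.
    rewrite !powRM ?subr_ge0// ?ltW// powRB; last by rewrite (gt_eqF d0) implybT.
    by field; rewrite !gt_eqF// powR_gt0.
  have I : mu.-integrable `]0, 1[ (fun y => ((1 - y) `^ A / y `^ s)%:E).
    by have := integrable_RL_beta A0 s1 ltr01; apply: eq_integrable => // y _ /=; rewrite subr0.
  rewrite integralZl//.
  have J : (\int[mu]_(x in `]0%R, 1%R[) ((1 - x) `^ A / x `^ s)%:E)%E \is a fin_num.
    exact: integrable_fin_num.
  rewrite !fineM ?fin_numM// /= gtr0_norm// mulrC [_ * fine _]mulrC -mulrA; congr (_ * _).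
  rewrite (_ : A + (1 - s) = (A - s) + 1); last by ring.
  by rewrite [RHS]powRD ?(gt_eqF d0) ?implybT// powRr1// ltW.
- by rewrite gt_eqF.
- by apply/measurable_EFinP; exact: measurable_RL_beta.
- by move=> y _; rewrite lee_fin divr_ge0 ?powR_ge0.
Qed.

Section RL.
Variable al : R.
Hypothesis al0 : 0 < al.
Let j := RL_index al.
Let sg : R := al - j%:R + 1.

Lemma RL_index_lt : sg < 1.
Proof. by rewrite /sg /j /RL_index; have := truncnS_gt al; lra. Qed.

Lemma RL_index_Gamma : 0 < j%:R - al <= 1.
Proof.
rewrite /j /RL_index; have := truncnS_gt al; rewrite subr_gt0 => -> /=.
by have := truncn_le al; rewrite (ltW al0) -natr1; lra.
Qed.

(** Expansion in powers of 1 - x, which makes the operator diagonal: D_+^al sends (1-x)^(al+i) to a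
    positive multiple of (1-x)^i. *)
Definition RL_sum (r : nat -> R) n : {poly R} := \sum_(i < n) r i *: (1 - 'X) ^+ i.

Definition RL_sum_int (r : nat -> R) n : {poly R} :=
  \sum_(i < n) (r i * RL_beta (al + i%:R) sg) *: (1 - 'X) ^+ (i + j).

Lemma RL_integral_sum r n x : x < 1 ->
  let v := fun y => (1 - y) `^ al * (RL_sum r n).[y] in
  mu.-integrable `]x, 1[ (fun y => (RL_kernel al v x y)%:E) /\
  RL_integral al v x = (RL_sum_int r n).[x].
Proof.
move=> x1; have s1 := RL_index_lt.
rewrite /RL_integral /RL_kernel -/j -/sg /RL_sum /RL_sum_int.
elim: n => [|n [IHi IHv]].
  split.
    apply: eq_integrable (integrable0 _ _) => // y _.
    by rewrite big_ord0 horner0 mulr0 mul0r.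
  rewrite (@eq_Rintegral _ _ _ mu _ (cst 0)); last first.
    by move=> y _; rewrite big_ord0 horner0 mulr0 mul0r.
  by rewrite Rintegral_cst// mul0r big_ord0 horner0.
have an0 : 0 <= al + n%:R by rewrite addr_ge0// ltW.
have In := integrableZl (measurable_itvR _) (r n) (integrable_RL_beta an0 s1 x1).
have E y : `]x, 1[%classic y ->
    (1 - y) `^ al * (\sum_(i < n.+1) r i *: (1 - 'X) ^+ i).[y] / (y - x) `^ sg =
    (1 - y) `^ al * (\sum_(i < n) r i *: (1 - 'X) ^+ i).[y] / (y - x) `^ sg +
    r n * ((1 - y) `^ (al + n%:R) / (y - x) `^ sg).
  rewrite /= in_itv/= => /andP[xy y1].
  rewrite big_ord_recr/= !hornerE/= powRD;
    last by rewrite [1 - y == 0]gt_eqF ?implybT// subr_gt0.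
  rewrite powR_mulrn ?subr_ge0 ?ltW//; ring.
split.
  have := integrableD (measurable_itvR _) IHi In; apply: eq_integrable => // y.
  by rewrite inE => /E ->.
rewrite (@eq_Rintegral _ _ _ mu _ (fun y =>
  (1 - y) `^ al * (\sum_(i < n) r i *: (1 - 'X) ^+ i).[y] / (y - x) `^ sg +
    r n * ((1 - y) `^ (al + n%:R) / (y - x) `^ sg))); last by move=> y; rewrite inE => /E.
rewrite RintegralD// IHv RintegralZl//; last exact: integrable_RL_beta.
rewrite RL_beta_affine// big_ord_recr/= !hornerE/=; congr (_ + _).
congr (_ * _).
(* The noninteger parts of al and [sg] cancel, which is why the Riemann-Liouville integral is a
   polynomial. *)
rewrite (_ : al + n%:R + 1 - sg = (n + j)%:R); last by rewrite /sg natrD; ring.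
by rewrite powR_mulrn// subr_ge0 ltW.
Qed.

Lemma derivn_1mX n k : ((1 - 'X : {poly R}) ^+ (n + k))^`(k) =
  ((-1) ^+ k * ((n + k) ^_ k)%:R) *: (1 - 'X) ^+ n.
Proof.
elim: k n => [|k IH] n; first by rewrite addn0 derivn0 ffactn0 mulr1 scale1r.
rewrite addnS derivSn deriv_exp /= derivB derivC derivX sub0r mulN1r.
rewrite derivnMn derivnN IH ffactnS /= exprS natrM -scaler_nat scalerN scalerA -scaleNr.
congr (_ *: _); ring.
Qed.

Lemma derivn_sum_1mX (c : nat -> R) n k :
  (\sum_(i < n) c i *: (1 - 'X : {poly R}) ^+ (i + k))^`(k) =
  \sum_(i < n) (c i * ((-1) ^+ k * ((i + k) ^_ k)%:R)) *: (1 - 'X) ^+ i.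
Proof.
elim: n => [|n IH]; first by rewrite !big_ord0 derivnC if_same.
by rewrite !big_ord_recr/= derivnD IH derivnZ derivn_1mX scalerA.
Qed.

Lemma RL_sum_intK (t : nat -> R) n : exists r : nat -> R,
  ((-1) ^+ j / Gamma (j%:R - al)) *: (RL_sum_int r n)^`(j) = RL_sum t n.
Proof.
have G0 := Gamma_gt0 RL_index_Gamma.
(* Division by the eigenvalue on (1-x)^(al+i): a beta value times a falling factorial, over Gamma(j
   - al). All three are positive. *)
pose r i := t i * Gamma (j%:R - al) / RL_beta (al + i%:R) sg / ((i + j) ^_ j)%:R.
exists r; rewrite /RL_sum_int /RL_sum (derivn_sum_1mX (fun i => r i * RL_beta (al + i%:R) sg)).
rewrite scaler_sumr /r; apply: eq_bigr => i _.
rewrite !scalerA; congr (_ *: _).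
have B0 : 0 < RL_beta (al + i%:R) sg.
  by apply: RL_beta_gt0; [rewrite addr_ge0// ltW|exact: RL_index_lt].
have F0 : ((i + j) ^_ j)%:R != 0 :> R by rewrite pnatr_eq0 -lt0n ffact_gt0 leq_addl.
have S : (-1) ^+ j * (-1) ^+ j = 1 :> R by rewrite -exprMn mulrNN mulr1 expr1n.
transitivity ((-1) ^+ j * (-1) ^+ j * t i); last by rewrite S mul1r.
by field; rewrite F0 !gt_eqF.
Qed.

Lemma size_1mX : size (1 - 'X : {poly R}) = 2.
Proof. by rewrite -[1 - 'X]opprB size_opp -polyC1 size_XsubC. Qed.

(** The map x -> 1 - x is an involution, so the coefficients of q(1 - x) are those of q in powers of
    1 - x. *)
Lemma polys_RL_sum N (q : {poly R}) : polys N q -> exists t : nat -> R, q = RL_sum t N.+1.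
Proof.
rewrite /polys/= => sq; exists (fun i => (q \Po (1 - 'X))`_i).
have sr : (size (q \Po (1 - 'X)) <= N.+1)%N.
  by rewrite size_comp_poly2// size_1mX.
transitivity ((q \Po (1 - 'X)) \Po (1 - 'X)).
  rewrite -comp_polyA comp_polyB comp_polyC comp_polyX subKr comp_polyXr//.
rewrite [LHS]comp_polyE /RL_sum.
rewrite -(big_mkord xpredT (fun i => (q \Po (1 - 'X))`_i *: (1 - 'X) ^+ i)).
rewrite -(big_mkord xpredT (fun i => (q \Po (1 - 'X))`_i *: (1 - 'X) ^+ i)).
rewrite [RHS](big_cat_nat _ sr)//= [X in _ = _ + X]big1_seq ?addr0// => i.
by rewrite mem_index_iota => /= /andP[si _]; rewrite nth_default ?scale0r.
Qed.

Lemma RL_sum_polys N (t : nat -> R) : polys N (RL_sum t N.+1).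
Proof.
rewrite /polys/=; apply: (leq_trans (size_sum _ _ _)); apply/bigmax_leqP => i _.
apply: (leq_trans (size_scale_leq _ _)); apply: (leq_trans (size_exp_leq _ _)).
by rewrite size_1mX mul1n.
Qed.

End RL.
End RL_poly.

(** * Uniqueness of weak derivatives *)

Section weak.
Context {R : realType}.
Implicit Types (f g F G phi : R -> R) (c d x y : R) (n k l : nat).
Local Notation mu := (@lebesgue_measure R).
Local Notation Lambda := (@Lambda R).

Lemma measurable_compact (K : set R) : compact K -> measurable (K : set (measurableTypeR R)).
Proof. exact: compact_measurable. Qed.

Lemma integrable_loc_itv g c d : locally_integrable Lambda g -> -1 < c -> d < 1 ->
  mu.-integrable `[c, d] (EFin \o g).
Proof.
move=> [mg _ Ig] c1 d1.
have cd : `[c, d]%classic `<=` Lambda.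
  move=> x; rewrite /Lambda/= !in_itv/= => /andP[? ?]; apply/andP; split; lra.
apply/integrableP; split; last exact: Ig (@segment_compact _ _ _).
by apply/measurable_EFinP; exact: (measurable_funS measurable_Lambda _ mg).
Qed.

Lemma test_function_bounded phi : test_function phi ->
  exists M, 0 < M /\ forall x, `|phi x| <= M.
Proof.
move=> tphi; have [_ [K [cK KL phi0]]] := tphi.
have cphi : {within K, continuous phi}.
  by apply: continuous_subspaceT => x; exact: test_function_continuous.
have /compact_bounded[M [_ HM]] := continuous_compact cphi cK.
exists (`|M| + 1); split; first by rewrite ltr_wpDl.
move=> x; have [Kx|nKx] := pselect (K x).
  apply: HM; last by exists x.
  by rewrite (le_lt_trans (ler_norm M))// ltrDl.
by rewrite phi0// normr0 addr_ge0.
Qed.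

Lemma measurable_test_function phi (D : set (measurableTypeR R)) :
  test_function phi -> measurable_fun D phi.
Proof.
move=> tphi; apply: measurable_funTS; apply: continuous_measurable_fun.
exact: test_function_continuous.
Qed.

Lemma integrable_test g phi : locally_integrable Lambda g -> test_function phi ->
  mu.-integrable Lambda (EFin \o (fun x => g x * phi x)).
Proof.
move=> [mg _ Ig] tphi; have [_ [K [cK KL phi0]]] := tphi.
have mK := measurable_compact cK.
have mgp : measurable_fun Lambda (fun x => g x * phi x).
  by apply: measurable_funM => //; exact: measurable_test_function.
have -> : Lambda = K `|` (Lambda `\` K).
  apply/seteqP; split => x; first by have [Kx|nKx] := pselect (K x); [left|right].
  by case=> [/KL|[]].
apply: integrableU => //; first exact: measurableD.
- by apply/disj_setPS => x [Kx [_ /(_ Kx)]].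
- have [M [M0 HM]] := test_function_bounded tphi.
  have IK : mu.-integrable K (EFin \o g).
    apply/integrableP; split; last exact: Ig.
    by apply/measurable_EFinP; exact: (measurable_funS measurable_Lambda _ mg).
  have := integrableZl mK M IK; apply: le_integrable => //.
    by apply/measurable_EFinP; exact: (measurable_funS measurable_Lambda _ mgp).
  move=> x Kx; rewrite /= lee_fin !normrM mulrC (gtr0_norm M0).
  by rewrite ler_wpM2r.
- apply: (@eq_integrable _ _ _ _ _ _ (cst 0%E)); [exact: measurableD| |exact: integrable0].
  by move=> x; rewrite inE => -[_ nK]; rewrite /= phi0// mulr0.
Qed.

Lemma Rintegral_sub0 (D E : set (measurableTypeR R)) f : D `<=` E ->
  (forall x, E x -> ~ D x -> f x = 0) ->
  \int[mu]_(x in E) f x = \int[mu]_(x in D) f x.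
Proof.
move=> DE f0; rewrite Rintegral_mkcond [RHS]Rintegral_mkcond.
apply: eq_Rintegral => x _; rewrite !patchE.
have [xD|xD] := boolP (x \in D); first by rewrite mem_set//; apply/DE/set_mem.
case: ifPn => // /set_mem xE; apply: f0 => //.
by move=> Dx; move: xD; rewrite mem_set.
Qed.

Lemma dominated_Rintegral (D : set (measurableTypeR R)) (f_ : nat -> R -> R) f g :
  measurable D -> (forall n, measurable_fun D (f_ n)) ->
  (forall x, D x -> f_ n x @[n --> \oo] --> f x) ->
  mu.-integrable D (EFin \o g) -> (forall n x, D x -> `|f_ n x| <= g x) ->
  measurable_fun D f ->
  mu.-integrable D (EFin \o f) /\
  \int[mu]_(x in D) f_ n x @[n --> \oo] --> \int[mu]_(x in D) f x.
Proof.
move=> mD mf cf Ig fg mfl.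
have gf x : D x -> `|f x| <= g x.
  move=> Dx; have := cf x Dx => /cvg_norm cfx.
  rewrite -(cvg_lim _ cfx)//; apply: limr_le; first by apply/cvg_ex; eexists; exact: cfx.
  by apply: nearW => n; exact: fg.
have If : mu.-integrable D (EFin \o f).
  apply: le_integrable Ig => //; first exact/measurable_EFinP.
  by move=> x Dx; rewrite /= lee_fin (le_trans (gf x Dx))// ler_norm.
split=> //; apply: fine_cvg; rewrite fineK; last exact: integrable_fin_num.
apply: (@dominated_cvg _ _ _ mu D mD _ (EFin \o f) (EFin \o g)) => //.
- by move=> n; exact/measurable_EFinP.
- by move=> x Dx; apply/fine_cvgP; split; [exact: nearW|exact: cf].
Qed.

(** All the bumps live on [c, d], where g is integrable, so |g| dominates and the limit of the
    tested integrals is the integral over ]c, d[. *)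
Lemma bump_itv0 g c d : locally_integrable Lambda g -> -1 < c -> c < d -> d < 1 ->
  (forall phi, test_function phi -> \int[mu]_(x in Lambda) (g x * phi x) = 0) ->
  \int[mu]_(x in `]c, d[) g x = 0.
Proof.
move=> lg c1 cd d1 g0.
have sub : `]c, d[%classic `<=` `[c, d]%classic by apply: subset_itv_oo_cc.
have Ig : mu.-integrable `]c, d[ (EFin \o g).
  exact: (integrableS (measurable_itvR _) (measurable_itvR _) sub (integrable_loc_itv lg c1
    d1)).
have mg : measurable_fun `]c, d[%classic g by apply/measurable_EFinP; exact: measurable_int Ig.
have mb n : measurable_fun `]c, d[%classic (fun x => g x * flat_bump c d n x).
  apply: measurable_funM => //; apply: measurable_test_function.
  exact: test_function_flat_bump.
have cb x : `]c, d[%classic x -> g x * flat_bump c d n x @[n --> \oo] --> g x.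
  rewrite /= in_itv/= => cxd; rewrite -[X in _ --> X]mulr1.
  by apply: cvgM; [exact: cvg_cst|exact: cvg_flat_bump].
have nb n x : `]c, d[%classic x -> `|g x * flat_bump c d n x| <= `|g x|.
  move=> _; rewrite normrM ler_piMr//.
  have /andP[h1 h2] := flat_exp01 (flat_bump_poly c d n).[x].
  by rewrite ger0_norm.
have [_ cv] := dominated_Rintegral (measurable_itvR _) mb cb (integrable_norm Ig) nb mg.
apply: cvg_unique cv _ => //.
rewrite (_ : (fun n => _) = cst 0); first exact: cvg_cst.
apply/funext => n /=; rewrite -(@Rintegral_sub0 _ Lambda).
- by apply: g0; exact: test_function_flat_bump.
- move=> x; rewrite /Lambda/= !in_itv/= => /andP[? ?]; apply/andP; split; lra.
- move=> x _ ncd; rewrite [flat_bump _ _ _ _]flat_poly_le0 ?mulr0// flat_bump_polyE.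
  move: ncd; rewrite /= in_itv/= => /negP; rewrite negb_and -!leNgt => /orP[h|h].
    by rewrite mulr_ge0_le0// mulr_le0_ge0//; lra.
  by rewrite mulr_ge0_le0// mulr_ge0_le0//; lra.
Qed.

(** The fundamental lemma of the calculus of variations. On ]c, d[ with closure in [Lambda], the
    primitive of g from c vanishes by [bump_itv0], and by Lebesgue differentiation its derivative is
    g almost everywhere. Countably many such intervals exhaust [Lambda]. *)
Lemma test_ae0 g : locally_integrable Lambda g ->
  (forall phi, test_function phi -> \int[mu]_(x in Lambda) (g x * phi x) = 0) ->
  {ae mu, forall x, Lambda x -> g x = 0}.
Proof.
move=> lg g0.
pose e k : R := k.+2%:R^-1.
have e0 k : 0 < e k by rewrite invr_gt0.
have H k : {ae mu, forall x, `]-1 + e k, 1 - e k[%classic x -> g x = 0}.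
  set c := -1 + e k; set d := 1 - e k.
  have [c1 d1] : -1 < c /\ d < 1 by rewrite /c /d; have := e0 k; lra.
  (* Lebesgue differentiation is applied to the extension by 0, which is integrable on the whole
     line. *)
  pose gk := g \_ `]c, d[.
  have sub : `]c, d[%classic `<=` `[c, d]%classic by apply: subset_itv_oo_cc.
  have Ig : mu.-integrable `]c, d[ (EFin \o g).
    exact: (integrableS (measurable_itvR _) (measurable_itvR _) sub (integrable_loc_itv lg
      c1 d1)).
  have lgk : locally_integrable setT gk by apply: integrable_locally_restrict.
  have IT : mu.-integrable setT (EFin \o gk).
    by rewrite /gk -restrict_EFin; exact: (integrable_mkcond _ (measurable_itvR _)).1.
  have Igk y : mu.-integrable [set` Interval (BRight c) (BRight y)] (EFin \o gk).
    exact: integrableS IT.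
  have := FTC1 Igk lgk.
  apply: filterS; first exact: (ae_filter_ringOfSetsType mu).
  move=> x /= Fx; rewrite in_itv/= => /andP[cx xd].
  have [] := Fx; first by rewrite lte_fin.
  move=> dF; rewrite /gk patchE mem_set/= ?in_itv/= ?cx// => <-.
  have oU : open `]c, d[%classic by exact: interval_open.
  pose Fg x := \int[mu]_(t in [set` Interval (BRight c) (BRight x)]) gk t.
  have F0 y : `]c, d[%classic y -> cst 0 y = Fg y.
    rewrite /= in_itv/= => /andP[cy yd]; rewrite /Fg.
    rewrite -Rintegral_itv_bndo_bndc; last exact: integrableS IT.
    rewrite (@eq_Rintegral _ _ _ mu _ g).
      by rewrite bump_itv0//; lra.
    move=> t; rewrite inE/= in_itv/= => /andP[ct ty].
    by rewrite /gk patchE mem_set//= in_itv/= ct (lt_trans ty).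
  have cxd : `]c, d[%classic x by rewrite /= in_itv/= cx.
  have [_ ->] := open_eq_derive1 oU F0 cxd (derivable_cst _ _ _).
  by rewrite derive1_cst.
have := ae_foralln H; apply: filterS => x Hx /LambdaP /andP[x1 x2].
have [e1 e2] : 0 < Num.min (1 + x) (1 - x) /\ True by split => //; rewrite lt_min; lra.
have [k /= _ kx] := near_infty_natSinv_lt (PosNum e1).
have := kx k.+1 (leqnSn k); rewrite /= lt_min -/(e k) => /andP[h1 h2].
by apply: (Hx k); rewrite /= in_itv/=; move: (e k) h1 h2 => ek h1 h2; lra.
Qed.

End weak.

(** * Calculus of weak derivatives *)

Section wderive.
Context {R : realType}.
Implicit Types (f g F G phi : R -> R) (c d x y : R) (n k l : nat) (p q : {poly R}).
Local Notation mu := (@lebesgue_measure R).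
Local Notation Lambda := (@Lambda R).

Lemma ae_imply (P Q : R -> Prop) : (forall x, P x -> Q x) ->
  {ae mu, forall x, P x} -> {ae mu, forall x, Q x}.
Proof. exact: (@filterS _ _ (ae_filter_ringOfSetsType mu)). Qed.

Lemma ae_imply2 (P Q S : R -> Prop) : (forall x, P x -> Q x -> S x) ->
  {ae mu, forall x, P x} -> {ae mu, forall x, Q x} -> {ae mu, forall x, S x}.
Proof. exact: (@filterS2 _ _ (ae_filter_ringOfSetsType mu)). Qed.

Lemma Rintegral_ae_eq (D : set (measurableTypeR R)) f g : measurable D ->
  measurable_fun D f -> measurable_fun D g ->
  {ae mu, forall x, D x -> f x = g x} ->
  \int[mu]_(x in D) f x = \int[mu]_(x in D) g x.
Proof.
move=> mD mf mg fg; rewrite /Rintegral; congr fine; apply: ae_eq_integral => //.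
- exact/measurable_EFinP.
- exact/measurable_EFinP.
by apply: ae_imply fg => x /= fgx /fgx ->.
Qed.

(** The means of comparing the chosen representative [wderive] with an explicit derivative. *)
Lemma is_wderive_unique n F f g : is_wderive n F f -> is_wderive n F g ->
  {ae mu, forall x, Lambda x -> f x = g x}.
Proof.
move=> [_ lf Hf] [_ lg Hg].
have : {ae mu, forall x, Lambda x -> f x - g x = 0}.
  apply: test_ae0 (locally_integrableB lf lg) _ => phi tphi.
  have := Hf _ tphi; rewrite (Hg _ tphi) => /(congr1 ( *%R ((-1) ^+ n))).
  rewrite !mulrA -!exprMn !mulrNN !mulr1 !expr1n !mul1r => E.
  rewrite (@eq_Rintegral _ _ _ mu _ (fun x => f x * phi x - g x * phi x)).
    by rewrite RintegralB ?E ?subrr//; exact: integrable_test.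
  by move=> x _; rewrite /= mulrBl.
by apply: ae_imply => x H /H /eqP; rewrite subr_eq0 => /eqP.
Qed.

Lemma is_wderiveB n F G f g : is_wderive n F f -> is_wderive n G g ->
  is_wderive n (fun x => F x - G x) (fun x => f x - g x).
Proof.
move=> [lF lf Hf] [lG lg Hg]; split; [exact: locally_integrableB..|] => phi tphi.
have tphin := test_function_deriven n tphi.
under eq_Rintegral do rewrite mulrBl.
under [in RHS]eq_Rintegral do rewrite mulrBl.
rewrite !RintegralB//; try exact: integrable_test.
by rewrite Hf// Hg// mulrBr.
Qed.

Lemma locally_integrableZ c f : locally_integrable Lambda f ->
  locally_integrable Lambda (fun x => c * f x).
Proof.
move=> [mf oD If]; split=> //; first exact: measurable_funM.
move=> K KL cK; under eq_integral do rewrite normrM EFinM.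
have mK := measurable_compact cK.
rewrite ge0_integralZl//; first by rewrite lte_mul_pinfty//; exact: If.
apply/measurable_EFinP; apply: measurableT_comp => //.
exact: (measurable_funS measurable_Lambda KL mf).
Qed.

Lemma is_wderiveZ n c F f : is_wderive n F f ->
  is_wderive n (fun x => c * F x) (fun x => c * f x).
Proof.
move=> [lF lf Hf]; split; [exact: locally_integrableZ..|] => phi tphi.
have tphin := test_function_deriven n tphi.
under eq_Rintegral do rewrite -mulrA.
under [in RHS]eq_Rintegral do rewrite -mulrA.
rewrite !RintegralZl//; try exact: integrable_test.
by rewrite Hf// mulrCA.
Qed.

(** The derivative of order l of a test function is a test function, so the integral of F times
    phi^(n+l) can be evaluated in two ways. This relates two Riemann-Liouville derivatives without
    referring back to the integral. *)
Lemma is_wderive_shift n l F f g : is_wderive n F f -> is_wderive (n + l) F g ->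
  is_wderive l f g.
Proof.
move=> [_ lf Hf] [_ lg Hg]; split=> // phi tphi.
have := Hf _ (test_function_deriven l tphi).
rewrite /derive1n -iterD -/(derive1n _ _) (Hg _ tphi) => /(congr1 ( *%R ((-1) ^+ n))).
rewrite exprD -!mulrA [RHS]mulrA [LHS]mulrA -!exprMn !mulrNN !mulr1 !expr1n !mul1r.
by move=> ->.
Qed.

Lemma is_wderive_eq_ae n F G f : is_wderive n F f -> locally_integrable Lambda G ->
  {ae mu, forall x, Lambda x -> F x = G x} -> is_wderive n G f.
Proof.
move=> [[mF _ _] lf Hf] lG FG; have [mG _ _] := lG.
split => // phi tphi; rewrite -Hf//; apply: Rintegral_ae_eq => //.
- apply: measurable_funM => //; apply: measurable_test_function.
  exact: test_function_deriven.
- apply: measurable_funM => //; apply: measurable_test_function.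
  exact: test_function_deriven.
by apply: ae_imply FG => x H /H ->.
Qed.

Lemma locally_integrable_eq f g : (forall x, Lambda x -> f x = g x) ->
  locally_integrable Lambda f -> locally_integrable Lambda g.
Proof.
move=> fg [mf oD If]; split=> //.
  by apply: eq_measurable_fun mf => x; rewrite inE => /fg.
move=> K KL cK; rewrite (@eq_integral _ _ _ mu _ (fun x => `|f x|%:E)).
  exact: If.
by move=> x; rewrite inE => /KL/fg ->.
Qed.

Lemma is_wderive_eq n F G f g : (forall x, Lambda x -> F x = G x) ->
  (forall x, Lambda x -> f x = g x) -> is_wderive n F f -> is_wderive n G g.
Proof.
move=> FG fg [lF lf Hf]; split;
  [exact: locally_integrable_eq lF|exact: locally_integrable_eq lf|].
move=> phi tphi; rewrite -(@eq_Rintegral _ _ _ mu _ (fun x =>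
  G x * derive1n n phi x) (fun x => F x * derive1n n phi x)).
  rewrite Hf//; congr (_ * _); apply: eq_Rintegral => x; rewrite inE => /fg -> //.
by move=> x; rewrite inE => /FG ->.
Qed.

Lemma continuous_locally_integrable f : continuous f -> locally_integrable Lambda f.
Proof.
move=> cf; split; [|exact: open_Lambda|].
  by apply: measurable_funTS; exact: continuous_measurable_fun.
move=> K KL cK; have : mu.-integrable K (EFin \o f).
  by apply: continuous_compact_integrable => //; exact: continuous_subspaceT.
by case/integrableP.
Qed.

Lemma continuous_horner p : continuous (horner p : R -> R).
Proof.
by move=> x; apply/differentiable_continuous/derivable1_diffP/derivable_horner.
Qed.

Lemma test_function_out phi x : test_function phi -> ~ Lambda x -> phi x = 0.
Proof. by move=> [_ [K [_ KL phi0]]] nx; apply: phi0 => /KL. Qed.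

Lemma is_wderive1_horner p : is_wderive 1 (horner p) (horner p^`()).
Proof.
split; [exact/continuous_locally_integrable/continuous_horner..|].
move=> phi tphi; rewrite derive1n1 expr1 mulN1r.
have t' := test_function_derive tphi.
have L1 : ~ Lambda 1 by rewrite LambdaP ltxx andbF.
have L2 : ~ Lambda (-1) by rewrite LambdaP ltxx.
have sub : Lambda `<=` `[-1, 1]%classic by exact: subset_itv_oo_cc.
have ex f : (forall x, ~ Lambda x -> f x = 0) ->
    \int[mu]_(x in Lambda) f x = \int[mu]_(x in `[-1, 1]) f x.
  by move=> f0; rewrite [RHS](@Rintegral_sub0 _ Lambda) => // x _; exact: f0.
rewrite !ex; last 2 first.
- by move=> x nx; rewrite (test_function_out tphi)// mulr0.
- by move=> x nx; rewrite (test_function_out t')// mulr0.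
rewrite (@Rintegration_by_parts _ (horner p) phi (horner p^`()) phi^`()%classic).
- by rewrite (test_function_out tphi L1) (test_function_out tphi L2) !mulr0 subrr sub0r.
- lra.
- exact/continuous_subspaceT/continuous_horner.
- split; first by move=> x _; exact: derivable_horner.
    by apply: cvg_at_right_filter; exact: continuous_horner.
  by apply: cvg_at_left_filter; exact: continuous_horner.
- by move=> x _; rewrite derivE.
- exact/continuous_subspaceT/test_function_continuous.
- split; first by move=> x _; exact: test_function_derivable.
    by apply: cvg_at_right_filter; exact: test_function_continuous.
  by apply: cvg_at_left_filter; exact: test_function_continuous.
- by [].
Qed.

Lemma is_wderive_trans n F f g : is_wderive n F f -> is_wderive 1 f g ->
  is_wderive n.+1 F g.
Proof.
move=> [lF _ Hf] [_ lg Hg]; split=> // phi tphi.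
rewrite derive1Sn Hf; last exact: test_function_derive.
by have := Hg _ tphi; rewrite derive1n1 expr1 => ->; rewrite exprSr mulrA.
Qed.

Lemma is_wderive_horner n p : is_wderive n (horner p) (horner p^`(n)).
Proof.
elim: n => [|n IH].
  split; [exact/continuous_locally_integrable/continuous_horner..|].
  by move=> phi _; rewrite derive1n0 expr0 mul1r derivn0.
by apply: is_wderive_trans IH _; rewrite derivnS; exact: is_wderive1_horner.
Qed.

Lemma wderiveP n F : wderivable n F -> is_wderive n F (wderive n F).
Proof. by move=> [g Hg]; rewrite /wderive; case: xgetP => [h -> //|/(_ g)]. Qed.

Lemma wderive_out n F : ~ wderivable n F -> wderive n F = cst 0.
Proof. by move=> nF; rewrite /wderive; case: xgetP => // h _ Hh; case: nF; exists h. Qed.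
End wderive.

(** * Weighted L2 spaces *)

Section L2.
Context {R : realType}.
Implicit Types (f g h phi : R -> R) (a b c x y : R) (n k : nat) (p q : {poly R}).
Local Notation mu := (@lebesgue_measure R).
Local Notation Lambda := (@Lambda R).

Lemma quad_discr (A B C : R) : 0 <= C -> (forall t, 0 <= A - 2 * t * B + t ^+ 2 * C) ->
  B ^+ 2 <= A * C.
Proof.
rewrite le_eqVlt => /predU1P[<-|C0] H.
  have [->|B0] := eqVneq B 0; first by rewrite expr0n/= mulr0.
  (* For C = 0 and B nonzero this t gives the value -1, a contradiction. For C > 0, below, B/C is
     the minimiser. *)
  have := H ((A + 1) / (2 * B)); rewrite mulr0 addr0.
  rewrite (_ : 2 * _ * B = A + 1); last by field.
  lra.
have := H (B / C); rewrite (_ : A - _ + _ = (A * C - B ^+ 2) / C); last by field;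
  rewrite gt_eqF.
by rewrite pmulr_lge0 ?invr_gt0// subr_ge0.
Qed.

Section weighted.
Variable w : R -> R.
Hypothesis mw : measurable_fun Lambda w.
Hypothesis w0 : forall x, 0 <= w x.

Local Notation L2 := (in_L2 w).
Local Notation inn := (inner w).

Lemma L2_measurable f g : L2 f -> L2 g -> measurable_fun Lambda (fun x => f x * g x * w x).
Proof. by move=> [mf _] [mg _]; do 2 apply: measurable_funM => //. Qed.

Lemma L2_prod f g : L2 f -> L2 g -> mu.-integrable Lambda (EFin \o (fun x => f x * g x * w x)).
Proof.
move=> Lf Lg; have [mf If] := Lf; have [mg Ig] := Lg.
have := integrableD measurable_Lambda If Ig; apply: le_integrable => //.
  by apply/measurable_EFinP; exact: L2_measurable.
move=> x _; rewrite /= lee_fin normrM (ger0_norm (w0 x)) -mulrDl [leRHS]ger0_norm; last first.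
  by rewrite mulr_ge0// addr_ge0// -expr2 sqr_ge0.
rewrite ler_wpM2r// normrM.
have := sqr_ge0 (`|f x| - `|g x|); have := normr_ge0 (f x); have := normr_ge0 (g x).
rewrite -[f x * f x]expr2 -[g x * g x]expr2 -(real_normK (num_real (f x))) -(real_normK
  (num_real (g x))).
nra.
Qed.

Lemma L2D f g : L2 f -> L2 g -> L2 (fun x => f x + g x).
Proof.
move=> Lf Lg; have [mf If] := Lf; have [mg Ig] := Lg; split; first exact: measurable_funD.
have I1 := L2_prod Lf Lg.
have := integrableD measurable_Lambda (integrableD measurable_Lambda If I1)
  (integrableD measurable_Lambda Ig I1).
by apply: eq_integrable => // x _; rewrite /= -!EFinD; congr EFin; ring.
Qed.

Lemma L2Z c f : L2 f -> L2 (fun x => c * f x).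
Proof.
move=> [mf If]; split; first exact: measurable_funM.
have := integrableZl measurable_Lambda (c * c) If.
by apply: eq_integrable => // x _; rewrite /= -!EFinM; congr EFin; ring.
Qed.

Lemma L2_eq f g : (forall x, f x = g x) -> L2 f -> L2 g.
Proof. by move=> /funext ->. Qed.

Lemma L2B f g : L2 f -> L2 g -> L2 (fun x => f x - g x).
Proof.
move=> Lf Lg; apply: L2_eq (L2D Lf (L2Z (-1) Lg)) => x.
by rewrite mulN1r.
Qed.

Lemma innerC f g : inn f g = inn g f.
Proof. by apply: eq_Rintegral => x _; ring. Qed.

Lemma innerDl f g h : L2 f -> L2 g -> L2 h -> inn (fun x => f x + g x) h = inn f h + inn g h.
Proof.
move=> Lf Lg Lh; rewrite /inner -RintegralD//; [|exact: L2_prod..].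
by apply: eq_Rintegral => x _; ring.
Qed.

Lemma innerZl c f h : L2 f -> L2 h -> inn (fun x => c * f x) h = c * inn f h.
Proof.
move=> Lf Lh; rewrite /inner -RintegralZl//; last exact: L2_prod.
by apply: eq_Rintegral => x _; ring.
Qed.

Lemma innerBl f g h : L2 f -> L2 g -> L2 h -> inn (fun x => f x - g x) h = inn f h - inn g h.
Proof.
move=> Lf Lg Lh; rewrite /inner -RintegralB//; [|exact: L2_prod..].
by apply: eq_Rintegral => x _; ring.
Qed.

Lemma innerDr f g h : L2 f -> L2 g -> L2 h -> inn h (fun x => f x + g x) = inn h f + inn h g.
Proof. by move=> *; rewrite innerC innerDl// !(innerC h). Qed.

Lemma innerZr c f h : L2 f -> L2 h -> inn h (fun x => c * f x) = c * inn h f.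
Proof. by move=> *; rewrite innerC innerZl// !(innerC h). Qed.

Lemma innerBr f g h : L2 f -> L2 g -> L2 h -> inn h (fun x => f x - g x) = inn h f - inn h g.
Proof. by move=> *; rewrite innerC innerBl// !(innerC h). Qed.

Lemma inner_ge0 f : 0 <= inn f f.
Proof. by apply: Rintegral_ge0 => x _; rewrite mulr_ge0// -expr2 sqr_ge0. Qed.

Lemma inner_CS f g : L2 f -> L2 g -> inn f g ^+ 2 <= inn f f * inn g g.
Proof.
move=> Lf Lg; apply: quad_discr; first exact: inner_ge0.
move=> t; have := inner_ge0 (fun x => f x - t * g x).
have Lt := L2Z t Lg.
rewrite innerBl//; last exact: L2B.
rewrite !innerBr//; rewrite innerZr// !innerZl// innerZr// (innerC g f).
by congr (0 <= _); ring.
Qed.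

Lemma inner_eq_on f f' g g' : (forall x, Lambda x -> f x = f' x) ->
  (forall x, Lambda x -> g x = g' x) -> inn f g = inn f' g'.
Proof. by move=> ff gg; apply: eq_Rintegral => x; rewrite inE => Lx; rewrite ff// gg. Qed.

Lemma inner_ae_eq f g : measurable_fun Lambda f -> measurable_fun Lambda g ->
  {ae mu, forall x, Lambda x -> f x = g x} -> inn f f = inn g g.
Proof.
move=> mf mg fg; apply: Rintegral_ae_eq => //; try by do 2 apply: measurable_funM => //.
by apply: ae_imply fg => x fgx Lx; rewrite fgx.
Qed.

Hypothesis Iw : mu.-integrable Lambda (EFin \o w).

Lemma L2_bounded f M : measurable_fun Lambda f -> (forall x, Lambda x -> `|f x| <= M) -> L2 f.
Proof.
move=> mf fM; split=> //.
have := integrableZl measurable_Lambda (M ^+ 2) Iw; apply: le_integrable => //.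
  by apply/measurable_EFinP; do 2 apply: measurable_funM => //.
move=> x Lx; rewrite /= lee_fin !normrM (ger0_norm (w0 x)) ler_wpM2r//.
rewrite -expr2 -expr2 lerXn2r ?nnegrE//.
by rewrite (le_trans (fM x Lx))// ler_norm.
Qed.

Lemma L2_continuous f : continuous f -> L2 f.
Proof.
move=> cf.
have cf' : {within `[-1, 1]%classic, continuous f} by exact: continuous_subspaceT.
have /compact_bounded[M [_ HM]] := continuous_compact cf' (@segment_compact _ (-1) 1).
apply: (@L2_bounded _ (`|M| + 1)).
  by apply: measurable_funTS; exact: continuous_measurable_fun.
move=> x Lx; apply: HM; first by rewrite (le_lt_trans (ler_norm M))// ltrDl.
by exists x => //; exact: (@subset_itv_oo_cc _ _ (-1) 1).
Qed.

Lemma L2_horner p : L2 (horner p).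
Proof. exact/L2_continuous/continuous_horner. Qed.

End weighted.
End L2.

(** * Integration by parts against Jacobi weights *)

Section parts.
Context {R : realType}.
Implicit Types (f g h phi : R -> R) (a b c x y : R) (n k : nat) (p q : {poly R}).
Local Notation mu := (@lebesgue_measure R).
Local Notation Lambda := (@Lambda R).
Local Notation W := (@jacobi_weight R).

Lemma flat_expS_near k : {near +oo, (fun x : R => x^-1 * flat_exp k x) =1 flat_exp k.+1}.
Proof.
near=> x; rewrite flat_expS mulrA mulVf ?mul1r// gt_eqF//.
Unshelve. all: by end_near. Qed.

Lemma cvg_flat_expS k : flat_exp k.+1 x @[x --> +oo] --> (0 : R).
Proof.
have H m l : flat_exp m x @[x --> +oo] --> (l : R) -> flat_exp m.+1 x @[x --> +oo] --> (0 : R).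
  move=> kl; have : x^-1 * flat_exp m x @[x --> +oo] --> (0 : R).
    by rewrite -[X in _ --> X](mul0r l); apply: cvgM => //; exact: cvg_invr_pinfty.
  by apply: cvg_trans; apply: near_eq_cvg; exact: flat_expS_near.
by elim: k => [|k IH]; [exact: H cvg_flat_exp0|exact: H IH].
Qed.

Lemma is_derive_cutoff n x :
  is_derive x 1 (cutoff n) (- 2 * n%:R * x * flat_exp 2 (cutoff_poly n).[x]).
Proof.
have d1 := is_derive_poly (cutoff_poly n) x.
have d2 := is_derive_flat_exp 0 (cutoff_poly n).[x].
have := @is_derive1_comp _ (flat_exp 0) (horner (cutoff_poly n)) x _ _ d2 d1.
move=> /is_derive_eq; apply; rewrite /cutoff_poly.
rewrite derivB derivZ derivB derivC derivXn !hornerE/=.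
ring.
Qed.

(* The factor 1 - x^2 gained by the weight W(a+1,b+1) over W(a,b) absorbs the
   derivative of the cutoff. *)
Lemma cutoff_deriveM n x :
  (1 - x ^+ 2) * (cutoff n)^`()%classic x =
  - 2 * x * (flat_exp 1 (cutoff_poly n).[x] + flat_exp 2 (cutoff_poly n).[x]).
Proof.
have := is_derive_cutoff n x => d; rewrite derive1E derive_val.
(* With s the value of [cutoff_poly n], n (1 - x^2) = s + 1, and s times [flat_exp 2 s] is
   [flat_exp 1 s]: the factor n disappears. *)
rewrite (flat_expS 1) cutoff_polyE; ring.
Qed.

Lemma cutoff_derive_bound n x : Lambda x -> `|(1 - x ^+ 2) * (cutoff n)^`()%classic x| <= 16.
Proof.
move=> /LambdaP/andP[x1 x2]; rewrite cutoff_deriveM.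
set s := (cutoff_poly n).[x].
have h1 : 0 <= flat_exp 1 s := flat_exp_ge0 1 s.
have h2 : 0 <= flat_exp 2 s := flat_exp_ge0 2 s.
have h3 : flat_exp 1 s <= 2 := flat_exp_le 1 s.
have h4 : flat_exp 2 s <= 6 := flat_exp_le 2 s.
have xn : `|x| <= 1 by rewrite ler_norml; lra.
rewrite normrM (ger0_norm (addr_ge0 h1 h2)) normrM normrN (@ger0_norm _ 2)//.
(* Here 8 = 2! + 3!, from the bounds on [flat_exp 1] and [flat_exp 2]. *)
rewrite (_ : 16 = 2 * 8); last by ring.
apply: ler_pM; rewrite ?mulr_ge0 ?addr_ge0//; first by rewrite ler_piMr.
by lra.
Qed.

Lemma cvg_cutoff_derive x : Lambda x ->
  (1 - x ^+ 2) * (cutoff n)^`()%classic x @[n --> \oo] --> (0 : R).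
Proof.
move=> /LambdaP/andP[x1 x2]; under eq_fun do rewrite cutoff_deriveM cutoff_polyE.
have H k : flat_exp k.+1 (n%:R * (1 - x ^+ 2) - 1) @[n --> \oo] --> (0 : R).
  by apply: cvg_comp (cvg_flat_expS k); apply: cvg_natM_pinfty; nra.
have := cvgM (cvg_cst (- 2 * x)) (cvgD (H 0%N) (H 1%N)).
by rewrite addr0 mulr0; exact.
Qed.

(* Minus the weighted divergence, (q W(a+1,b+1))' = - jacobi_op a b q * W(a,b):
   the adjoint of d/dx from L2(W(a,b)) to L2(W(a+1,b+1)). *)
Definition jacobi_op a b q : {poly R} :=
  (a + 1) *: ((1 + 'X) * q) - (b + 1) *: ((1 - 'X) * q) - (1 - 'X^2) * q^`().

Lemma powRS x a : 0 < x -> x `^ (a + 1) = x * x `^ a.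
Proof.
move=> x0; rewrite powRD; last by rewrite (gt_eqF x0) implybT.
by rewrite powRr1 ?ltW// mulrC.
Qed.

Lemma weightS a b x : Lambda x -> W (a + 1) (b + 1) x = (1 - x ^+ 2) * W a b x.
Proof.
move=> /LambdaP/andP[x1 x2]; rewrite /jacobi_weight.
have h1 : 0 < 1 - x by lra.
have h2 : 0 < 1 + x by lra.
by rewrite !powRS//; ring.
Qed.

Lemma is_derive_weight a b q x : Lambda x ->
  is_derive x 1 (fun x => q.[x] * W (a + 1) (b + 1) x) (- (jacobi_op a b q).[x] * W a b x).
Proof.
move=> Lx; have /LambdaP/andP[x1 x2] := Lx.
have h1 : 0 < 1 - x by lra.
have h2 : 0 < 1 + x by lra.
have dq := is_derive_poly q x.
have e1 : is_derive x 1 (fun x : R => 1 - x) (-1).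
  exact: (is_derive_eq (is_deriveB (is_derive_cst (1 : R) x 1) (is_derive_id x 1)) (sub0r 1)).
have e2 : is_derive x 1 (fun x : R => 1 + x) 1.
  exact: (is_derive_eq (is_deriveD (is_derive_cst (1 : R) x 1) (is_derive_id x 1)) (add0r 1)).
have d1 := @is_derive1_comp _ (fun y => y `^ (a + 1)) (fun x =>
  1 - x) x _ _ (is_derive1_powR (a + 1) h1) e1.
have d2 := @is_derive1_comp _ (fun y => y `^ (b + 1)) (fun x =>
  1 + x) x _ _ (is_derive1_powR (b + 1) h2) e2.
have := is_deriveM dq (is_deriveM d1 d2).
move=> /is_derive_eq; apply; rewrite /GRing.scale/= !fctE/= !addrK /jacobi_op !hornerE/=.
by rewrite /jacobi_weight !powRS//; ring.
Qed.

Lemma Cn_weight a b q n : Cn n Lambda (fun x => q.[x] * W a b x).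
Proof.
have oL := @open_Lambda R.
apply: CnM => //; first exact: Cn_horner.
apply: CnM => //.
- apply: (@Cn_comp _ _ _ `]0, +oo[%classic (fun y => y `^ a) (fun x => 1 - x)) => //.
  + by move=> x /LambdaP/andP[? ?]; rewrite /= in_itv/= andbT; lra.
  + exact: Cn_powR.
  + apply: (@Cn_eq _ _ _ (horner (1 - 'X))) => //; last exact: Cn_horner.
    by move=> x _; rewrite !hornerE.
- apply: (@Cn_comp _ _ _ `]0, +oo[%classic (fun y => y `^ b) (fun x => 1 + x)) => //.
  + by move=> x /LambdaP/andP[? ?]; rewrite /= in_itv/= andbT; lra.
  + exact: Cn_powR.
  + apply: (@Cn_eq _ _ _ (horner (1 + 'X))) => //; last exact: Cn_horner.
    by move=> x _; rewrite !hornerE.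
Qed.

Lemma cvg_Rintegral_bounded (u_ : nat -> R -> R) (u h : R -> R) (C : R) :
  (forall n, measurable_fun Lambda (u_ n)) ->
  (forall n x, Lambda x -> `|u_ n x| <= C) ->
  (forall x, Lambda x -> u_ n x @[n --> \oo] --> u x) ->
  mu.-integrable Lambda (EFin \o h) ->
  (forall n, mu.-integrable Lambda (EFin \o (fun x => u_ n x * h x))) /\
  \int[mu]_(x in Lambda) (u_ n x * h x) @[n --> \oo] --> \int[mu]_(x in Lambda) (u x * h x).
Proof.
move=> mu_ bu cu Ih.
have mh : measurable_fun Lambda h by apply/measurable_EFinP; exact: measurable_int Ih.
have IC : mu.-integrable Lambda (EFin \o (fun x => C * `|h x|)).
  exact: integrableZl (integrable_norm Ih).
have mun n : measurable_fun Lambda (fun x => u_ n x * h x) by exact: measurable_funM.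
have bun n x : Lambda x -> `|u_ n x * h x| <= C * `|h x|.
  by move=> Lx; rewrite normrM ler_wpM2r// bu.
have cun x : Lambda x -> u_ n x * h x @[n --> \oo] --> u x * h x.
  by move=> Lx; apply: cvgM; [exact: cu|exact: cvg_cst].
split.
  move=> n; apply: le_integrable IC => //; first by apply/measurable_EFinP; exact: mun.
  by move=> x Lx; rewrite /= lee_fin (le_trans (bun n x Lx))// ler_norm.
have muh : measurable_fun Lambda (fun x => u x * h x).
  exact: (measurable_fun_cvg mun cun).
exact: (dominated_Rintegral measurable_Lambda mun cun IC bun muh).2.
Qed.

(** The function q W(a+1,b+1) is not compactly supported, so it is multiplied by [cutoff n] before
    testing. In the derivative of the product, the term that differentiates the cutoff is bounded by
    a constant times |f q| W(a,b), since W(a+1,b+1) = (1 - x^2) W(a,b), and tends to 0 pointwise; it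
    disappears in the limit and no boundary term is left. *)
Lemma inner_jacobi_op a b f g q : -1 < a -> -1 < b ->
  in_L2 (W a b) f -> in_L2 (W (a + 1) (b + 1)) g -> is_wderive 1 f g ->
  inner (W a b) f (horner (jacobi_op a b q)) = inner (W (a + 1) (b + 1)) g (horner q).
Proof.
move=> a1 b1 Lf Lg [lf lg fg].
have [mf _] := Lf; have [mg _] := Lg.
have a2 : -1 < a + 1 by lra.
have b2 : -1 < b + 1 by lra.
have mw (a' b' : R) : measurable_fun Lambda (W a' b') by exact: measurable_weight.
have Lq (a' b' : R) r (a1' : -1 < a') (b1' : -1 < b') :=
  L2_horner (mw a' b') (weight_ge0 a' b') (integrable_weight a1' b1') r.
have mh r := (Lq a b r a1 b1).1.
pose phi n x := cutoff n x * (q.[x] * W (a + 1) (b + 1) x).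
have tphi n : test_function (phi n).
  by apply: test_functionM; [exact: test_function_cutoff|exact: Cn_weight].
have dphi n x : Lambda x -> (phi n)^`()%classic x =
   (1 - x ^+ 2) * (cutoff n)^`()%classic x * (q.[x] * W a b x) -
   cutoff n x * ((jacobi_op a b q).[x] * W a b x).
  move=> Lx; have dw := is_derive_weight a b q Lx; have dc := is_derive_cutoff n x.
  have := is_deriveM dc dw => d.
  rewrite derive1E derive_val /GRing.scale/= weightS//.
  rewrite derive1E; have -> : 'D_1 (cutoff n) x = _ := derive_val.
  ring.
have mc n : measurable_fun Lambda (cutoff n).
  by apply: measurable_test_function; exact: test_function_cutoff.
have mdc n : measurable_fun Lambda (fun x => (1 - x ^+ 2) * (cutoff n)^`()%classic x).
  apply: measurable_funM; first by apply: measurable_funB => //; exact: exprn_measurable.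
  by apply: measurable_test_function; exact/test_function_derive/test_function_cutoff.
have c01 n x : 0 <= cutoff n x <= 1 by exact: flat_exp01.
have If := L2_prod (mw a b) (weight_ge0 a b) Lf (Lq a b q a1 b1).
have IL := L2_prod (mw a b) (weight_ge0 a b) Lf (Lq a b (jacobi_op a b q) a1 b1).
have Ig := L2_prod (mw (a + 1) (b + 1)) (weight_ge0 (a + 1) (b + 1)) Lg (Lq (a + 1) (b
  + 1) q a2 b2).
have [I1 c1] := cvg_Rintegral_bounded mdc cutoff_derive_bound cvg_cutoff_derive If.
have cb n x : Lambda x -> `|cutoff n x| <= 1.
  by move=> _; have /andP[h1 h2] := c01 n x; rewrite ger0_norm.
have [I2 c2] := cvg_Rintegral_bounded mc cb cvg_cutoff IL.
have [I3 c3] := cvg_Rintegral_bounded mc cb cvg_cutoff Ig.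
have E n : \int[mu]_(x in Lambda) (cutoff n x * (g x * q.[x] * W (a + 1) (b + 1) x)) =
  \int[mu]_(x in Lambda) (cutoff n x * (f x * (jacobi_op a b q).[x] * W a b x)) -
  \int[mu]_(x in Lambda) ((1 - x ^+ 2) * (cutoff n)^`()%classic x * (f x * q.[x] * W a b x)).
  rewrite -RintegralB//; have := fg _ (tphi n).
  rewrite derive1n1 expr1 mulN1r => /esym/eqP; rewrite eqr_oppLR => /eqP fgn.
  rewrite (@eq_Rintegral _ _ _ mu _ (fun x => g x * phi n x)).
    rewrite fgn -mulN1r -RintegralZl//; last first.
      exact: integrable_test lf (test_function_derive (tphi n)).
    by apply: eq_Rintegral => x; rewrite inE => Lx; rewrite dphi//; ring.
  by move=> x _; rewrite /phi; ring.
move: c3; under eq_fun do rewrite E.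
move=> /(cvg_unique _ (cvgB c2 c1)) /=; rewrite /inner.
have e1 (v : R -> R) : \int[mu]_(x in Lambda) (1 * v x) = \int[mu]_(x in Lambda) v x.
  by apply: eq_Rintegral => x _; rewrite mul1r.
have e0 (v : R -> R) : \int[mu]_(x in Lambda) (0 * v x) = 0.
  rewrite (@eq_Rintegral _ _ _ mu _ (cst 0)); last by move=> x _; rewrite mul0r.
  by rewrite Rintegral_cst// mul0r.
by rewrite !e1 e0 subr0; apply.
Qed.
End parts.

(** * Sharp Poincare inequality for polynomials *)

Section poly_poincare.
Context {R : realType}.
Implicit Types (f g h : R -> R) (a b c x y : R) (n k K : nat) (p q r : {poly R}).
Local Notation mu := (@lebesgue_measure R).
Local Notation Lambda := (@Lambda R).
Local Notation W := (@jacobi_weight R).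

Definition ip a b p q : R := inner (W a b) (horner p) (horner q).

Lemma L2_weight_horner a b p : -1 < a -> -1 < b -> in_L2 (W a b) (horner p).
Proof.
move=> a1 b1; apply: L2_horner;
  [exact: measurable_weight|exact: weight_ge0|exact: integrable_weight].
Qed.

Section proj.
Variable w : R -> R.
Hypothesis mw : measurable_fun Lambda w.
Hypothesis w0 : forall x, 0 <= w x.
Hypothesis Iw : mu.-integrable Lambda (EFin \o w).

Let Lh p : in_L2 w (horner p) := L2_horner mw w0 Iw p.

(** K is a dimension: [perp K] concerns degrees below K, so that [polys N] corresponds to K = N +
    1. *)
Definition perp K f := forall r, (size r <= K)%N -> inner w f (horner r) = 0.

Lemma size_split K r : (size r <= K.+1)%N ->
  exists s : {poly R}, (size s <= K)%N /\ r = s + r`_K *: 'X^K.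
Proof.
move=> sr; exists (r - r`_K *: 'X^K); split; last by rewrite subrK.
apply/leq_sizeP => j Kj; rewrite coefB coefZ coefXn.
have [->|jK] := eqVneq j K; first by rewrite mulr1 subrr.
rewrite mulr0 subr0 nth_default// (leq_trans sr)//.
by rewrite ltn_neqAle eq_sym jK.
Qed.

Lemma inner_hornerDr f p q : in_L2 w f ->
  inner w f (horner (p + q)) = inner w f (horner p) + inner w f (horner q).
Proof.
by move=> Lf; rewrite -innerDr//; apply: inner_eq_on => // x _; rewrite hornerD.
Qed.

Lemma inner_hornerZr f c p : in_L2 w f ->
  inner w f (horner (c *: p)) = c * inner w f (horner p).
Proof.
by move=> Lf; rewrite -innerZr//; apply: inner_eq_on => // x _; rewrite hornerZ.
Qed.

(** Gram-Schmidt by induction on the dimension. The new direction E is X^K minus its own projection,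
    taken from the same induction hypothesis, which is why f is generalised. *)
Lemma inner_proj K f : in_L2 w f -> exists q, (size q <= K)%N /\ perp K (fun x => f x - q.[x]).
Proof.
elim: K f => [|K IH] f Lf.
  exists 0; rewrite size_poly0; split=> // r; rewrite leqn0 size_poly_eq0 => /eqP ->.
  rewrite /inner (@eq_Rintegral _ _ _ mu _ (cst 0)).
    by rewrite Rintegral_cst// mul0r.
  by move=> x _; rewrite horner0 mulr0 mul0r.
have [q [sq fq]] := IH _ Lf.
have [e [se He]] := IH _ (Lh 'X^K).
pose E := 'X^K - e.
have HE : perp K (horner E).
  by move=> r sr; rewrite -(He r sr); apply: inner_eq_on => // x _; rewrite hornerD hornerN.
have Lfq := L2B mw w0 Lf (Lh q).
pose c := inner w (fun x => f x - q.[x]) (horner E) / inner w (horner E) (horner E).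
have cE : inner w (fun x => f x - q.[x]) (horner E) = c * inner w (horner E) (horner E).
  (* If <E, E> = 0, then c is 0 by the convention on division, and Cauchy-Schwarz makes the
     left-hand side 0 as well. *)
  have [E0|E0] := eqVneq (inner w (horner E) (horner E)) 0; last by rewrite divfK.
  have := inner_CS mw w0 Lfq (Lh E); rewrite E0 !mulr0 => h.
  by apply/eqP; rewrite -sqrf_eq0 eq_le h sqr_ge0.
exists (q + c *: E); split.
  apply: (leq_trans (size_add _ _)); rewrite geq_max (leqW sq)/=.
  apply: (leq_trans (size_scale_leq _ _)); apply: (leq_trans (size_add _ _)).
  by rewrite size_polyXn size_opp geq_max leqnn (leqW se).
move=> r /size_split[s [ss ->]].
have LE := L2Z c (Lh E).
have eqf t : inner w (fun x => f x - (q + c *: E).[x]) (horner t) =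
    inner w (fun x => f x - q.[x]) (horner t) - c * inner w (horner E) (horner t).
  rewrite -innerZl// -innerBl//; apply: inner_eq_on => // x _.
  by rewrite hornerD hornerZ; ring.
rewrite eqf inner_hornerDr// inner_hornerDr// (fq s ss) (HE s ss) !inner_hornerZr// !add0r.
have EX : inner w (horner E) (horner 'X^K) = inner w (horner E) (horner E).
  by rewrite -[in LHS](subrK e 'X^K) -/E (inner_hornerDr E e (Lh E)) (HE e se) addr0.
have fX : inner w (fun x => f x - q.[x]) (horner 'X^K) = inner w (fun x =>
  f x - q.[x]) (horner E).
  by rewrite -[in LHS](subrK e 'X^K) -/E (inner_hornerDr E e Lfq) (fq e se) addr0.
by rewrite EX fX cE; ring.
Qed.

End proj.

Lemma ip_op a b p q : -1 < a -> -1 < b ->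
  ip a b p (jacobi_op a b q) = ip (a + 1) (b + 1) p^`() q.
Proof.
move=> a1 b1; apply: inner_jacobi_op => //.
- exact: L2_weight_horner.
- by apply: L2_weight_horner; lra.
- exact: is_wderive1_horner.
Qed.

Lemma jacobi_op_deriv a b q : (jacobi_op a b q)^`() =
  jacobi_op (a + 1) (b + 1) q^`() + (a + b + 2) *: q.
Proof.
rewrite /jacobi_op !(derivB, derivZ, derivM, derivD, derivC, derivX, derivXn)/=.
rewrite -!mul_polyC !(polyCD, polyC1, polyC_natr) expr1; ring.
Qed.

(** Adjointness at (a, b), the commutation rule, then adjointness again at (a+1, b+1), where the
    operator produced by the rule lives. *)
Lemma ip_op_norm a b q : -1 < a -> -1 < b ->
  ip a b (jacobi_op a b q) (jacobi_op a b q) =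
  ip (a + 1 + 1) (b + 1 + 1) q^`() q^`() + (a + b + 2) * ip (a + 1) (b + 1) q q.
Proof.
move=> a1 b1.
have a2 : -1 < a + 1 by lra.
have b2 : -1 < b + 1 by lra.
rewrite ip_op// jacobi_op_deriv /ip innerC.
rewrite inner_hornerDr ?inner_hornerZr; first by rewrite -/(ip _ _ _ _) ip_op//.
all: try exact: L2_weight_horner.
all: try exact: measurable_weight.
all: try exact: integrable_weight.
all: try (move=> x; exact: weight_ge0).
Qed.

Lemma jacobi_opD a b p q : jacobi_op a b (p + q) = jacobi_op a b p + jacobi_op a b q.
Proof. by rewrite /jacobi_op derivD !mulrDr !scalerDr; ring. Qed.

Lemma jacobi_opZ a b c p : jacobi_op a b (c *: p) = c *: jacobi_op a b p.
Proof.
rewrite /jacobi_op derivZ -!scalerAr !scalerBr !scalerA.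
by rewrite ![c * _]mulrC.
Qed.

Lemma jacobi_opXn a b n : exists s : {poly R}, (size s <= n.+1)%N /\
  jacobi_op a b 'X^n = (n%:R + a + b + 2) *: 'X^(n.+1) + s.
Proof.
exists ((a - b) *: 'X^n - n%:R *: 'X^(n.-1)); split.
  apply: (leq_trans (size_add _ _)); rewrite size_opp geq_max.
  rewrite !(leq_trans (size_scale_leq _ _)) ?size_polyXn//.
  by case: n.
rewrite /jacobi_op derivXn -!mul_polyC !(polyCD, polyCN, polyC1, polyC_natr).
case: n => [|n] /=; first by rewrite expr0 mulr0n expr1; ring.
by rewrite !exprS; ring.
Qed.

(** L raises the degree by exactly one: on X^k the leading coefficient k + a + b + 2 is positive.
    Leading terms are removed until a constant remains. *)
Lemma jacobi_op_surj a b p : -1 < a -> -1 < b -> exists q c, p = jacobi_op a b q + c%:P.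
Proof.
move=> a1 b1; have [n] := ubnP (size p); elim: n p => // n IH p.
rewrite ltnS => sp.
have [p1|p1] := leqP (size p) 1.
  exists 0, p`_0; rewrite {1}(size1_polyC p1) /jacobi_op deriv0 !mulr0 !scaler0 !subr0 add0r//.
case: n IH sp => [|[|k]] IH sp; [by move: (leq_trans p1 sp)..|].
have [s [ss pE]] := size_split sp.
have [t [st HX]] := jacobi_opXn a b k.
have l0 : 0 < k%:R + a + b + 2 by have := ler0n R k; lra.
pose d := p`_k.+1 / (k%:R + a + b + 2).
have [|q [c E]] := IH (s - d *: t).
  rewrite ltnS; apply: (leq_trans (size_add _ _)); rewrite size_opp geq_max ss/=.
  exact: leq_trans (size_scale_leq _ _) st.
exists (q + d *: 'X^k), c.
rewrite jacobi_opD jacobi_opZ HX addrAC -E {1}pE scalerDr scalerA /d divfK ?gt_eqF//; ring.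
Qed.

Lemma ip_11_gt0 a b : -1 < a -> -1 < b -> 0 < ip a b 1 1.
Proof.
move=> a1 b1; apply: (Rintegral_gt0 (@measurable_Lambda R)).
- rewrite /Defs.Lambda lebesgue_measure_itv/= ifT; last by rewrite lte_fin; lra.
  by rewrite -EFinD lte_fin; lra.
- have := integrable_weight a1 b1; apply: eq_integrable => // x _ /=.
  by rewrite hornerC !mul1r.
- by move=> x Lx; rewrite hornerC !mul1r weight_gt0.
Qed.

(** L q is orthogonal to 1 because 1' = 0, so the constant c left over by [jacobi_op_surj] satisfies
    c <1, 1> = 0. *)
Lemma jacobi_op_range a b p : -1 < a -> -1 < b -> ip a b p 1 = 0 ->
  exists q, p = jacobi_op a b q.
Proof.
move=> a1 b1; have [q [c ->]] := jacobi_op_surj p a1 b1.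
have L1 r := @L2_weight_horner a b r a1 b1.
rewrite /ip innerC inner_hornerDr //; try exact: measurable_weight;
  try exact: integrable_weight; last by move=> x; exact: weight_ge0.
rewrite -/(ip _ _ _ _) ip_op// derivC.
rewrite (_ : ip _ _ 0 q = 0); last first.
  rewrite /ip /inner (@eq_Rintegral _ _ _ mu _ (cst 0)).
    by rewrite Rintegral_cst// mul0r.
  by move=> x _; rewrite horner0 !mul0r.
rewrite add0r -[c%:P]mulr1 mul_polyC inner_hornerZr//; try exact: measurable_weight;
  try exact: integrable_weight; last by move=> x; exact: weight_ge0.
move=> /eqP; rewrite mulf_eq0 (gt_eqF (ip_11_gt0 a1 b1)) orbF => /eqP ->.
by exists q; rewrite scale0r addr0.
Qed.

Lemma poly_primitive K r : (size r <= K)%N -> exists s : {poly R},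
  (size s <= K.+1)%N /\ s^`() = r.
Proof.
move=> sr; exists (\poly_(i < K.+1) (r`_i.-1 / i%:R)); split; first exact: size_poly.
apply/polyP => i; rewrite coef_deriv coef_poly ltnS.
have [iK|Ki] := ltnP i K; last first.
  by rewrite mul0rn nth_default// (leq_trans sr).
by rewrite /= -[LHS]mulr_natr divfK// pnatr_eq0.
Qed.

(** <g, r> = <f, L r>, and L raises the degree of r by at most one. *)
Lemma perp_derive a b K f g : -1 < a -> -1 < b ->
  in_L2 (W a b) f -> in_L2 (W (a + 1) (b + 1)) g -> is_wderive 1 f g ->
  perp (W a b) K.+1 f -> perp (W (a + 1) (b + 1)) K g.
Proof.
move=> a1 b1 Lf Lg fg pf r sr.
rewrite -(inner_jacobi_op r a1 b1 Lf Lg fg); apply: pf.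
apply: (leq_trans (size_add _ _)); rewrite size_opp geq_max.
have s1 : (size (1 + 'X : {poly R})%R <= 2)%N.
  by rewrite (leq_trans (size_add _ _))// geq_max size_poly1 size_polyX.
have s2 : (size (1 - 'X^2 : {poly R})%R <= 3)%N.
  by rewrite (leq_trans (size_add _ _))// geq_max size_poly1 size_opp size_polyXn.
have sM (u v : {poly R}) i j : (size u <= i.+1)%N -> (size v <= j)%N ->
  (size (u * v)%R <= i + j)%N.
  move=> hu hv; apply: (leq_trans (size_mul_leq _ _)).
  by rewrite -subn1 leq_subLR add1n -addSn leq_add.
apply/andP; split.
  apply: (leq_trans (size_add _ _)); rewrite size_opp geq_max.
  by rewrite !(leq_trans (size_scale_leq _ _))// -add1n sM// size_1mX.
case: K sr => [|K] sr.
  by move: sr; rewrite leqn0 size_poly_eq0 => /eqP ->; rewrite deriv0 mulr0 size_poly0.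
apply: (sM _ _ 2%N K) => //; have [->|r0] := eqVneq r 0; first by rewrite deriv0 size_poly0.
by rewrite -ltnS (leq_trans _ sr)// lt_size_deriv.
Qed.

(** A polynomial of degree below K is s' for some s of degree at most K, and <q, s'> = <L q, s>. *)
Lemma perp_jacobi_op a b K q : -1 < a -> -1 < b ->
  perp (W a b) K.+1 (horner (jacobi_op a b q)) -> perp (W (a + 1) (b + 1)) K (horner q).
Proof.
move=> a1 b1 pq r /poly_primitive[s [ss <-]].
by rewrite innerC -/(ip _ _ _ _) -ip_op// /ip innerC pq.
Qed.

(** For p = L q, take A = |p|^2, B = |q|^2 and E = |p'|^2: the estimate l B <= A for the adjoint and
    Cauchy-Schwarz on A = <p', q> give the estimate for d/dx, after cancelling one factor A. *)
Lemma CS_cancel (l A B E : R) : 0 <= l -> 0 <= A -> 0 <= E -> l * B <= A ->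
  A ^+ 2 <= E * B -> l * A <= E.
Proof.
move=> l0; rewrite le_eqVlt => /predU1P[<- *|A0 E0 lB AE]; first by rewrite mulr0.
rewrite -(ler_pM2r A0); apply: (@le_trans _ _ (E * (l * B))); last by rewrite ler_wpM2l.
by rewrite -mulrA -expr2 [leRHS]mulrCA ler_wpM2l.
Qed.

(* This is the step (a,b,K+1) from (a+1,b+1,K), for the adjoint operator:
   K(K+a+b+3) + (a+b+2) = (K+1)(K+a+b+2). *)
Lemma poincare_op_poly K a b q : -1 < a -> -1 < b ->
  (perp (W (a + 1) (b + 1)) K (horner q) ->
   K%:R * (K%:R + (a + 1) + (b + 1) + 1) * ip (a + 1) (b + 1) q q <=
   ip (a + 1 + 1) (b + 1 + 1) q^`() q^`()) ->
  perp (W a b) K.+1 (horner (jacobi_op a b q)) ->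
  K.+1%:R * (K.+1%:R + a + b + 1) * ip (a + 1) (b + 1) q q <=
  ip a b (jacobi_op a b q) (jacobi_op a b q).
Proof.
move=> a1 b1 IH pp; rewrite ip_op_norm//.
have := IH (perp_jacobi_op a1 b1 pp); rewrite -natr1.
set B := ip _ _ q q; set D := ip _ _ _ _ => h.
have -> : (K%:R + 1) * (K%:R + 1 + a + b + 1) * B =
  K%:R * (K%:R + (a + 1) + (b + 1) + 1) * B + (a + b + 2) * B by ring.
by rewrite lerD2r.
Qed.

Lemma inner_weight_ge0 a b f : 0 <= inner (W a b) f f.
Proof. by apply: inner_ge0 => x; exact: weight_ge0. Qed.

Lemma inner_weight_CS a b f g : in_L2 (W a b) f -> in_L2 (W a b) g ->
  inner (W a b) f g ^+ 2 <= inner (W a b) f f * inner (W a b) g g.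
Proof. by apply: inner_CS; [exact: measurable_weight|move=> x; exact: weight_ge0]. Qed.

Lemma poincare_const_ge0 K a b : -1 < a -> -1 < b -> 0 <= K.+1%:R * (K.+1%:R + a + b + 1) :> R.
Proof. by move=> a1 b1; rewrite mulr_ge0// -natr1; have := ler0n R K; lra. Qed.

Lemma poincare_poly K a b p : -1 < a -> -1 < b -> perp (W a b) K (horner p) ->
  K%:R * (K%:R + a + b + 1) * ip a b p p <= ip (a + 1) (b + 1) p^`() p^`().
Proof.
elim: K a b p => [|K IH] a b p a1 b1 pp.
  by rewrite mul0r mul0r inner_weight_ge0.
have [q pE] : exists q, p = jacobi_op a b q.
  by apply: jacobi_op_range => //; apply: pp; rewrite size_poly1.
have a2 : -1 < a + 1 by lra.
have b2 : -1 < b + 1 by lra.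
apply: (@CS_cancel _ _ (ip (a + 1) (b + 1) q q)); try exact: inner_weight_ge0.
- exact: poincare_const_ge0.
- by rewrite pE in pp *; apply: poincare_op_poly => //; exact: IH.
have -> : ip a b p p = ip (a + 1) (b + 1) p^`() q by rewrite {2}pE ip_op.
by apply: inner_weight_CS; exact: L2_weight_horner.
Qed.

End poly_poincare.

(** * Density of polynomials *)

Section density.
Context {R : realType}.
Implicit Types (f g h : R -> R) (a b c x y t e M : R) (n k K : nat) (p q r : {poly R}) (u v
  : nat -> R).
Local Notation mu := (@lebesgue_measure R).
Local Notation Lambda := (@Lambda R).
Local Notation W := (@jacobi_weight R).

(* The Bernstein operator with value u k at the node k/n, through the binomial
   recursion; this makes its second moment an induction. *)
Fixpoint bern n u : {poly R} :=
  if n is m.+1 then (1 - 'X) * bern m u + 'X * bern m (u \o S) else (u 0%N)%:P.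

Lemma bernS n u t : (bern n.+1 u).[t] = (1 - t) * (bern n u).[t] + t * (bern n (u \o S)).[t].
Proof. by rewrite /= !hornerE. Qed.

Lemma bern_le n u v t : 0 <= t <= 1 -> (forall k, (k <= n)%N -> u k <= v k) ->
  (bern n u).[t] <= (bern n v).[t].
Proof.
move=> /andP[t0 t1]; elim: n u v => [|n IH] u v uv; first by rewrite /= !hornerC uv.
rewrite !bernS lerD// ler_wpM2l ?subr_ge0//; apply: IH => k kn; apply: uv => //.
exact: leqW.
Qed.

Lemma bern_cst n c t : (bern n (fun=> c)).[t] = c.
Proof.
elim: n => [|n IH]; first by rewrite /= hornerC.
by rewrite bernS (_ : (fun=> c) \o S = (fun=> c))// IH; ring.
Qed.

Lemma bernD n u v t : (bern n (fun k => u k + v k)).[t] = (bern n u).[t] + (bern n v).[t].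
Proof.
elim: n u v => [|n IH] u v; first by rewrite /= !hornerC.
rewrite !bernS IH (_ : (fun k => u k + v k) \o S = (fun k =>
  (u \o S) k + (v \o S) k))// IH; ring.
Qed.

Lemma bernZ n c u t : (bern n (fun k => c * u k)).[t] = c * (bern n u).[t].
Proof.
elim: n u => [|n IH] u; first by rewrite /= !hornerC.
rewrite !bernS IH (_ : (fun k => c * u k) \o S = (fun k => c * (u \o S) k))// IH; ring.
Qed.

Lemma bern_sqr n y t :
  (bern n (fun k => (k%:R - y) ^+ 2)).[t] = (n%:R * t - y) ^+ 2 + n%:R * (t * (1 - t)).
Proof.
elim: n y => [|n IH] y; first by rewrite /= hornerC !mul0r addr0.
rewrite bernS IH (_ : (fun k => (k%:R - y) ^+ 2) \o S = (fun k => (k%:R - (y - 1)) ^+ 2)).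
  by rewrite IH -[n.+1]addn1 natrD; ring.
by apply/funext => k /=; rewrite -[k.+1]addn1 natrD; ring.
Qed.

Lemma bern_bound n u M t : 0 <= t <= 1 -> (forall k, `|u k| <= M) -> `|(bern n u).[t]| <= M.
Proof.
move=> t01 uM; have uM' k : - M <= u k <= M by rewrite -ler_norml.
have lo : (bern n (fun=> - M)).[t] <= (bern n u).[t].
  by apply: bern_le => // k _; have /andP[] := uM' k.
have up : (bern n u).[t] <= (bern n (fun=> M)).[t].
  by apply: bern_le => // k _; have /andP[] := uM' k.
by rewrite !bern_cst in lo up; rewrite ler_norml lo.
Qed.

Definition bern_approx n h : {poly R} := bern n (fun k => h (k%:R / n%:R)).

(** Stated at a single point of continuity, since the functions to be approximated are continuous
    only on the open interval. The deviation |h t - h y| is at most e/2 + C (y - t)^2; the operator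
    is monotone, fixes constants, and has second moment t(1-t)/n about t. *)
Lemma cvg_bern_approx h M t : 0 <= t <= 1 -> (forall x, `|h x| <= M) ->
  {for t, continuous h} -> (bern_approx n h).[t] @[n --> \oo] --> h t.
Proof.
move=> t01 hM ct; apply/cvgrPdist_le => e e0.
have e20 : 0 < e / 2 by lra.
have M0 : 0 <= M by apply: le_trans (hM 0).
have [d d0 Hd] : exists2 d, 0 < d & forall y, `|t - y| < d -> `|h t - h y| <= e / 2.
  have /cvgrPdist_le/(_ _ e20)/nbhs_ballP[d /= d0 Hd] := ct.
  by exists d => // y yd; exact: Hd.
(* Chosen so that C (y - t)^2 >= 2 M as soon as |y - t| >= d. *)
pose C := 2 * M / d ^+ 2.
have C0 : 0 <= C by rewrite /C divr_ge0 ?exprn_ge0 ?mulr_ge0// ltW.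
have HC y : `|h t - h y| <= e / 2 + C * (y - t) ^+ 2.
  have [yd|yd] := ltP `|t - y| d.
    by rewrite (le_trans (Hd y yd))// lerDl mulr_ge0// sqr_ge0.
  apply: (@le_trans _ _ (2 * M)).
    by rewrite (le_trans (ler_normB _ _))// -[2]/(1 + 1) mulrDl !mul1r lerD.
  apply: (@le_trans _ _ (C * (y - t) ^+ 2)); last by rewrite lerDr ltW.
  rewrite /C -[leLHS]mulr1 -[leRHS]mulrA ler_wpM2l ?mulr_ge0// mulrC ler_pdivlMr
    ?exprn_gt0// mul1r.
  by rewrite -[leRHS]real_normK ?num_real// distrC lerXn2r ?nnegrE// ltW.
near=> n.
have n0 : 0 < n%:R :> R by near: n; exists 1%N => // n /= n1; rewrite ltr0n.
have up k : h (k%:R / n%:R) <= (h t + e / 2) + C / n%:R ^+ 2 * (k%:R - n%:R * t) ^+ 2.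
  have := HC (k%:R / n%:R); rewrite distrC => /(le_trans (ler_norm _)).
  rewrite lerBlDl addrA (_ : C * _ = C / n%:R ^+ 2 * (k%:R - n%:R * t) ^+ 2)//.
  by field; rewrite gt_eqF.
have lo k : (h t - e / 2) + - (C / n%:R ^+ 2) * (k%:R - n%:R * t) ^+ 2 <= h (k%:R / n%:R).
  have := HC (k%:R / n%:R) => /(le_trans (ler_norm _)).
  rewrite (_ : C * _ = C / n%:R ^+ 2 * (k%:R - n%:R * t) ^+ 2); last by field; rewrite gt_eqF.
  lra.
have val c0 c1 : (bern n (fun k => c0 + c1 * (k%:R - n%:R * t) ^+ 2)).[t] =
   c0 + c1 * (n%:R * (t * (1 - t))).
  by rewrite bernD bern_cst bernZ bern_sqr subrr expr0n add0r.
have hlo : h t - e / 2 + - (C / n%:R ^+ 2) * (n%:R * (t * (1 - t))) <= (bern_approx n h).[t].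
  by rewrite -val; apply: bern_le.
have hup : (bern_approx n h).[t] <= h t + e / 2 + C / n%:R ^+ 2 * (n%:R * (t * (1 - t))).
  by rewrite -val; apply: bern_le.
have small : C / n%:R ^+ 2 * (n%:R * (t * (1 - t))) <= e / 2.
  rewrite (_ : _ * _ = C * (t * (1 - t)) / n%:R); last by field; rewrite gt_eqF.
  rewrite ler_pdivrMr//; apply: (@le_trans _ _ C).
    by rewrite ler_piMr//; nra.
  rewrite mulrC -ler_pdivrMr//; near: n; exact: nbhs_infty_ger.
rewrite mulNr in hlo; rewrite ler_norml; apply/andP; split; lra.
Unshelve. all: by end_near. Qed.

(** * Truncation, and density in three stages: bounded, continuous, polynomial *)

Definition clamp M x : R := Num.max (- M) (Num.min M x).

Lemma clampP M x : 0 <= M -> [\/ x < - M /\ clamp M x = - M, [/\ - M <= x,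
  x <= M & clamp M x = x] | M < x /\ clamp M x = M].
Proof.
move=> M0; rewrite /clamp.
have [Mx|xM] := ltP M x.
  by apply: Or33; split => //; rewrite max_r//; lra.
have [xM'|Mx'] := ltP x (- M).
  by apply: Or31; split => //; rewrite max_l// ltW.
by apply: Or32; split => //; rewrite max_r.
Qed.

Lemma clamp_bound M x : 0 <= M -> `|clamp M x| <= M.
Proof. by move=> M0; rewrite ler_norml; have [[_ ->]|[? ? ->]|[_ ->]] := clampP x M0;
  apply/andP; split; lra. Qed.

Lemma clamp_lip M x y : 0 <= M -> `|clamp M x - clamp M y| <= `|x - y|.
Proof.
move=> M0; rewrite ler_norml; have := ler_norm (x - y); have := ler_norm (y - x);
  rewrite distrC.
by have [[? ->]|[? ? ->]|[? ->]] := clampP x M0; have [[? ->]|[? ? ->]|[? ->]] := clampP y M0;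
  move=> ? ?; apply/andP; split; lra.
Qed.

Lemma clamp_dist M x : 0 <= M -> `|x - clamp M x| <= `|x|.
Proof.
move=> M0; rewrite ler_norml; have := ler_norm x; have := ler_norm (- x); rewrite normrN.
by have [[? ->]|[? ? ->]|[? ->]] := clampP x M0; move=> ? ?; apply/andP; split; lra.
Qed.

Lemma clamp_id M x : `|x| <= M -> clamp M x = x.
Proof.
rewrite ler_norml => /andP[h1 h2]; have M0 : 0 <= M by lra.
by have [[? ->]|[? ? ->]|[? ->]] := clampP x M0; lra.
Qed.

Lemma measurable_clamp M (D : set (measurableTypeR R)) f :
  measurable_fun D f -> measurable_fun D (fun x => clamp M (f x)).
Proof.
by move=> mf; apply: measurable_maxr => //; apply: measurable_minr.
Qed.

Lemma continuous_clamp M f x : 0 <= M -> {for x, continuous f} ->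
  {for x, continuous (fun x => clamp M (f x))}.
Proof.
move=> M0 cf; apply/cvgrPdist_le => e e0.
have /cvgrPdist_le/(_ e e0) := cf; apply: filterS => y; apply: le_trans.
exact: clamp_lip.
Qed.
Lemma inner_add_le (w f g : R -> R) : measurable_fun Lambda w -> (forall x, 0 <= w x) ->
  in_L2 w f -> in_L2 w g ->
  inner w (fun x => f x + g x) (fun x => f x + g x) <= 2 * inner w f f + 2 * inner w g g.
Proof.
move=> mw w0 Lf Lg; have Lfg := L2D mw w0 Lf Lg; have Lfg' := L2B mw w0 Lf Lg.
have := inner_ge0 w0 (fun x => f x - g x).
rewrite innerBl// !innerBr// innerDl// !innerDr//; lra.
Qed.

Lemma cvg0_ex (s : nat -> R) e : s n @[n --> \oo] --> (0 : R) -> 0 < e -> exists n, s n <= e.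
Proof.
move=> /cvgrPdist_le h e0; have [N _ HN] := h _ e0; exists N.
by have := HN N (leqnn N); rewrite /= sub0r normrN; apply: le_trans; exact: ler_norm.
Qed.

Lemma Rintegral_zero : \int[mu]_(x in Lambda) (0 : R) = 0.
Proof. by rewrite Rintegral_cst// mul0r. Qed.

Section dense.
Variables a b : R.
Hypotheses (a1 : -1 < a) (b1 : -1 < b).
Let w := W a b.
Let mw : measurable_fun Lambda w := @measurable_weight R a b Lambda.
Let w0 : forall x, 0 <= w x := @weight_ge0 R a b.
Let Iw : mu.-integrable Lambda (EFin \o w) := integrable_weight a1 b1.

Local Notation sqdist f g := (inner w (fun x => f x - g x) (fun x => f x - g x)).

(** At each x the truncation at n is exact once n >= |f x|, and the error is dominated by f^2 w. *)
Lemma dense_clamp f e : in_L2 w f -> 0 < e ->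
  exists M, 0 <= M /\ sqdist f (fun x => clamp M (f x)) <= e.
Proof.
move=> [mf If] e0.
suff /cvg0_ex/(_ e0)[n Hn] : sqdist f (fun x => clamp n%:R (f x)) @[n --> \oo] --> (0 : R).
  by exists n%:R.
have mF n : measurable_fun Lambda (fun x =>
  (f x - clamp n%:R (f x)) * (f x - clamp n%:R (f x)) * w x).
  by do 2 apply: measurable_funM => //; apply: measurable_funB => //; exact: measurable_clamp.
have cF x : Lambda x -> (f x - clamp n%:R (f x)) * (f x
  - clamp n%:R (f x)) * w x @[n --> \oo] --> (0 : R).
  move=> _; apply: cvg_near_cst; near=> n.
  rewrite clamp_id ?subrr ?mul0r//; near: n; exact: nbhs_infty_ger.
have bF n x : Lambda x -> `|(f x - clamp n%:R (f x)) * (f x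
  - clamp n%:R (f x)) * w x| <= f x * f x * w x.
  move=> _; rewrite normrM (ger0_norm (w0 x)) ler_wpM2r// normrM.
  rewrite -[f x * f x]ger0_norm -?expr2 ?sqr_ge0// normrX expr2.
  by apply: ler_pM => //; exact: clamp_dist.
have [_] := dominated_Rintegral measurable_Lambda mF cF If bF (measurable_cst _).
by rewrite Rintegral_zero.
Unshelve. all: by end_near. Qed.

(** Passes through L1 of the Lebesgue measure: k w is approximated there by a continuous H, and h is
    H / w truncated at M. Truncation does not increase the distance to k, and |k - h|^2 w <= 2 M |k
    w - H| because both functions are bounded by M. *)
Lemma dense_continuous (k : R -> R) M e : measurable_fun Lambda k -> (forall x,
  `|k x| <= M) -> 0 < e ->
  exists h, [/\ measurable_fun Lambda h, forall x, `|h x| <= M,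
    forall x, Lambda x -> {for x, continuous h} & sqdist k h <= e].
Proof.
move=> mk kM e0.
have M0 : 0 <= M by apply: le_trans (kM 0).
have Lk : in_L2 w k by apply: (@L2_bounded _ w mw w0 Iw k M).
have Ikw : mu.-integrable Lambda (EFin \o (fun x => k x * w x)).
  have := L2_prod mw w0 Lk (L2_horner mw w0 Iw 1).
  by apply: eq_integrable => // x _; rewrite /= hornerC mulr1.
have muL : (mu Lambda < +oo)%E.
  by rewrite /Defs.Lambda lebesgue_measure_itv/= ifT ?lte_fin -?EFinD ?ltry//; lra.
have [H_ [cH IH /fine_cvgP[_ H0]]] :=
  approximation_continuous_integrable measurable_Lambda muL Ikw.
(* The summand 1 keeps the denominator positive when M = 0. *)
have e1 : 0 < e / (2 * M + 1) by rewrite divr_gt0//; lra.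
have [n Hn] := cvg0_ex H0 e1.
(* [W (- a) (- b)] is 1 / w on [Lambda]; the constant polynomial 1 gives the product the shape of
   [Cn_weight]. *)
pose h x := clamp M (H_ n x * ((1 : {poly R}).[x] * W (- a) (- b) x)).
have mh : measurable_fun Lambda h.
  apply: measurable_clamp; apply: measurable_funM; last first.
    apply: measurable_funM; last exact: measurable_weight.
    by apply: measurable_funTS; apply: continuous_measurable_fun; exact: continuous_horner.
  by apply: measurable_funTS; apply: continuous_measurable_fun; exact: cH.
exists h; split => //.
- by move=> x; exact: clamp_bound.
- move=> x Lx; apply: continuous_clamp => //; apply: continuousM; first exact: cH.
  apply/differentiable_continuous/derivable1_diffP.
  by have [+ _] := @Cn_weight R (- a) (- b) 1 1; apply.
have Lh : in_L2 w h by apply: (@L2_bounded _ w mw w0 Iw h M) => // x _; exact: clamp_bound.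
have Lkh := L2B mw w0 Lk Lh.
have IkH : mu.-integrable Lambda (EFin \o (fun x => `|k x * w x - H_ n x|)).
  exact: integrable_norm (integrableB measurable_Lambda Ikw (IH n)).
apply: (@le_trans _ _ (\int[mu]_(x in Lambda) (2 * M * `|k x * w x - H_ n x|))).
  apply: le_Rintegral => //.
  - exact: L2_prod.
  - exact: (integrableZl measurable_Lambda (2 * M) IkH).
  move=> x Lx; apply: (@le_trans _ _ (`|k x - h x| * `|k x - h x| * w x)).
    by rewrite -normrM ler_wpM2r// ler_norm.
  rewrite -mulrA; apply: ler_pM => //.
  - by rewrite mulr_ge0.
  - have hM : `|h x| <= M by exact: clamp_bound.
    by rewrite (le_trans (ler_normB _ _))// mulr_natl mulr2n lerD.
  have wx : 0 < w x by exact: weight_gt0.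
  have ww : W (- a) (- b) x * w x = 1.
    rewrite /w /jacobi_weight !powRN; move: wx; rewrite /w /jacobi_weight => wx.
    have /LambdaP/andP[x1 x2] := Lx.
    by field; rewrite !gt_eqF// powR_gt0//; lra.
  have -> : k x * w x - H_ n x = (k x - H_ n x * W (- a) (- b) x) * w x.
    by rewrite mulrBl -[in RHS]mulrA ww mulr1.
  rewrite normrM (gtr0_norm wx) ler_wpM2r//.
  by rewrite -{1}(clamp_id (kM x)) /h hornerC mul1r; exact: clamp_lip.
rewrite RintegralZl//.
have I0 : 0 <= \int[mu]_(x in Lambda) `|k x * w x - H_ n x| by apply: Rintegral_ge0.
have {}Hn : \int[mu]_(x in Lambda) `|k x * w x - H_ n x| <= e / (2 * M + 1) by exact: Hn.
apply: (@le_trans _ _ ((2 * M + 1) * (e / (2 * M + 1)))).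
  by apply: ler_pM => //; lra.
by rewrite mulrCA divff ?mulr1// gt_eqF//; lra.
Qed.

(** Since h may oscillate at the endpoints, its Bernstein polynomials converge only pointwise on
    [Lambda]; they inherit the bound M, so bounded convergence against the integrable weight
    concludes. *)
Lemma dense_poly h M e : measurable_fun Lambda h -> (forall x, `|h x| <= M) ->
  (forall x, Lambda x -> {for x, continuous h}) -> 0 < e ->
  exists p, sqdist h (horner p) <= e.
Proof.
move=> mh hM ch e0.
pose H t := h (2 * t - 1).
pose p n := bern_approx n H \Po (2^-1%:P * (1 + 'X)).
have pE n x : (p n).[x] = (bern_approx n H).[(1 + x) / 2].
  by rewrite horner_comp !hornerE mulrC.
suff /cvg0_ex/(_ e0)[n Hn] : sqdist h (horner (p n)) @[n --> \oo] --> (0 : R) by exists (p n).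
have mp n : measurable_fun Lambda (horner (p n)).
  by apply: measurable_funTS; apply: continuous_measurable_fun; exact: continuous_horner.
have mu_ n : measurable_fun Lambda (fun x => (h x - (p n).[x]) * (h x - (p n).[x])).
  by apply: measurable_funM; apply: measurable_funB.
have bp n x : Lambda x -> `|(p n).[x]| <= M.
  move=> /LambdaP/andP[x1 x2]; rewrite pE; apply: bern_bound; first by apply/andP; split; lra.
  by move=> k; exact: hM.
have bu n x : Lambda x -> `|(h x - (p n).[x]) * (h x - (p n).[x])| <= (M + M) * (M + M).
  by move=> Lx; rewrite normrM ler_pM// (le_trans (ler_normB _ _))// lerD// bp.
have cu x : Lambda x -> (h x - (p n).[x]) * (h x - (p n).[x]) @[n --> \oo] --> (0 : R).
  move=> Lx; have /LambdaP/andP[x1 x2] := Lx.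
  have cp : (p n).[x] @[n --> \oo] --> h x.
    under eq_fun do rewrite pE.
    have -> : h x = H ((1 + x) / 2) by rewrite /H; congr h; field.
    apply: (@cvg_bern_approx H M); first by apply/andP; split; lra.
      by move=> y; exact: hM.
    apply: (@continuous_comp _ _ _ (fun t : R => 2 * t - 1) h).
      apply: continuousB; last exact: cst_continuous.
      by apply: continuousM; [exact: cst_continuous|exact: cvg_id].
    rewrite (_ : 2 * ((1 + x) / 2) - 1 = x); last by field.
    exact: ch.
  have := cvgM (cvgB (cvg_cst (h x)) cp) (cvgB (cvg_cst (h x)) cp).
  by rewrite subrr mul0r; apply.
have [_] := cvg_Rintegral_bounded mu_ bu cu Iw.
rewrite (@eq_Rintegral _ _ _ mu _ (cst 0) (fun x => 0 * w x)); last by move=> x _;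
  rewrite mul0r.
by rewrite Rintegral_zero.
Qed.

Lemma poly_dense f e : in_L2 w f -> 0 < e -> exists p, sqdist f (horner p) <= e.
Proof.
move=> Lf e0; have [mf _] := Lf.
(* The inequality |x + y|^2 <= 2 |x|^2 + 2 |y|^2 is used twice, for a total of 2 (e/12) + 2 (2
   (e/12) + 2 (e/12)) = 10 e/12. *)
have e1 : 0 < e / 12 by lra.
have [M [M0 d1]] := dense_clamp Lf e1.
have mk : measurable_fun Lambda (fun x => clamp M (f x)) by exact: measurable_clamp.
have kM x : `|clamp M (f x)| <= M by exact: clamp_bound.
have [h [mh hM ch d2]] := dense_continuous mk kM e1.
have [p d3] := dense_poly mh hM ch e1.
exists p.
have Lk := @L2_bounded _ w mw w0 Iw _ M mk (fun x _ => kM x).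
have Lh := @L2_bounded _ w mw w0 Iw _ M mh (fun x _ => hM x).
have Lp := L2_horner mw w0 Iw p.
have A1 := inner_add_le mw w0 (L2B mw w0 Lf Lk) (L2B mw w0 Lk Lp).
have A2 := inner_add_le mw w0 (L2B mw w0 Lk Lh) (L2B mw w0 Lh Lp).
have E1 : sqdist f (horner p) = inner w (fun x => f x - clamp M (f x) + (clamp M (f x) - p.[x]))
   (fun x => f x - clamp M (f x) + (clamp M (f x) - p.[x])).
  by apply: inner_eq_on => x _; ring.
have E2 : sqdist (fun x => clamp M (f x)) (horner p) =
   inner w (fun x => clamp M (f x) - h x + (h x - p.[x])) (fun x =>
     clamp M (f x) - h x + (h x - p.[x])).
  by apply: inner_eq_on => x _; ring.
rewrite -E1 in A1; rewrite -E2 in A2; lra.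
Qed.

End dense.
End density.

(** * Sharp Poincare inequality in L2 *)

Section poincare.
Context {R : realType}.
Implicit Types (f g h u : R -> R) (a b c x y e : R) (n k K l m N : nat) (p q r : {poly R}).
Local Notation mu := (@lebesgue_measure R).
Local Notation Lambda := (@Lambda R).
Local Notation W := (@jacobi_weight R).

Lemma le0_small (X Y : R) : 0 <= Y -> (forall t, 0 < t < 1 -> X <= t * Y) -> X <= 0.
Proof.
move=> Y0 H; rewrite leNgt; apply/negP => X0.
have D0 : 0 < 2 * (Y + X) by lra.
have := H (X / (2 * (Y + X))); rewrite divr_gt0//= ltr_pdivrMr// => /(_ _)/wrap[]; first by lra.
rewrite mulrAC ler_pdivlMr// leNgt => /negP; apply; nra.
Qed.

(** The density argument in numbers: F = |f|^2, G = |f'|^2 and, for an approximating polynomial p, s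
    = <f, f - p>, d = |f - p|^2, B = |q|^2. Taking d <= t^2 F forces |s| <= t F, whence la F (1 -
    t)^2 <= G (1 + t)^2 for every t in ]0, 1[. *)
Lemma poincare_limit (la F G : R) : 0 <= la -> 0 <= F -> 0 <= G ->
  (forall e, 0 < e -> exists s d B, [/\ 0 <= d <= e, s ^+ 2 <= F * d,
     la * B <= F - 2 * s + d & (F - s) ^+ 2 <= G * B]) ->
  la * F <= G.
Proof.
move=> l0 F0 G0 H.
have [FE|Fn0] := eqVneq F 0; first by rewrite FE mulr0.
have Fp : 0 < F by rewrite lt_neqAle eq_sym Fn0.
(* Expanding the squares gives la F - G <= t (2 la F + 2 G + t G), and t < 1. *)
rewrite -subr_le0; apply: (@le0_small _ (2 * (la * F) + 3 * G)).
  by have := mulr_ge0 l0 F0; lra.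
move=> t /andP[t0 t1].
have e0 : 0 < t ^+ 2 * F by rewrite mulr_gt0// exprn_gt0.
have [s [d [B [/andP[d0 de] s2 B1 C1]]]] := H _ e0.
have tF : 0 <= t * F by rewrite mulr_ge0// ltW.
have /andP[sb1 sb2] : - (t * F) <= s <= t * F.
  rewrite -ler_norml -(ler_pXn2r (n := 2))// ?nnegrE// real_normK ?num_real//.
  apply: (le_trans s2); rewrite (_ : (t * F) ^+ 2 = F * (t ^+ 2 * F)); last by ring.
  by rewrite ler_wpM2l.
have C2 : la * (F - s) ^+ 2 <= G * (F - 2 * s + d).
  apply: (@le_trans _ _ (G * (la * B))); last by rewrite ler_wpM2l.
  by rewrite [leRHS]mulrCA ler_wpM2l.
have C3 : la * ((1 - t) * F) ^+ 2 <= G * ((1 + t) ^+ 2 * F).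
  apply: (@le_trans _ _ (la * (F - s) ^+ 2)).
    have le1 : 0 <= (1 - t) * F by rewrite mulr_ge0// subr_ge0 ltW.
    have le2 : (1 - t) * F <= F - s by rewrite mulrBl mul1r lerD2l lerN2.
    by rewrite ler_wpM2l// lerXn2r ?nnegrE// (le_trans le1).
  apply: (le_trans C2); rewrite ler_wpM2l//.
  rewrite (_ : (1 + t) ^+ 2 * F = F + 2 * (t * F) + t ^+ 2 * F); last by ring.
  lra.
have C4 : la * F * (1 - t) ^+ 2 <= G * (1 + t) ^+ 2.
  rewrite -(ler_pM2r Fp) (_ : la * F * _ * F = la * ((1 - t) * F) ^+ 2); last by ring.
  by rewrite -[leRHS]mulrA.
have laF := mulr_ge0 l0 F0.
have h1 := mulr_ge0 (sqr_ge0 t) laF.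
have h2 : 0 <= t * (1 - t) * G by rewrite !mulr_ge0 ?subr_ge0// ltW.
clear - h1 h2 C4; move: (la * F) h1 C4 => X h1 C4; lra.
Qed.

Lemma sqdist_expand (w : R -> R) f p : measurable_fun Lambda w -> (forall x, 0 <= w x) ->
  in_L2 w f -> in_L2 w (horner p) ->
  let D := fun x => f x - p.[x] in
  inner w f (horner p) = inner w f f - inner w f D /\
  inner w (horner p) (horner p) = inner w f f - 2 * inner w f D + inner w D D.
Proof.
move=> mw w0 Lf Lp D; have LD : in_L2 w D by exact: L2B.
have fD : inner w f D = inner w f f - inner w f (horner p) by exact: innerBr.
have DD : inner w D D = inner w f D - inner w (horner p) D by rewrite {1}/D innerBl.
have pD : inner w (horner p) D = inner w f (horner p) - inner w (horner p) (horner p).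
  by rewrite innerBr// (innerC _ (horner p) f).
split; lra.
Qed.

Lemma proj_le (w : R -> R) K p p' : measurable_fun Lambda w -> (forall x, 0 <= w x) ->
  (forall r, in_L2 w (horner r)) -> (size p' <= K)%N -> perp w K (horner (p - p')) ->
  inner w (horner (p - p')) (horner (p - p')) <= inner w (horner p) (horner p).
Proof.
move=> mw w0 Lh sp' Hpp; have Ltt := Lh (p - p'); have Lp' := Lh p'.
have -> : inner w (horner p) (horner p) =
    inner w (fun x => (p - p').[x] + p'.[x]) (fun x => (p - p').[x] + p'.[x]).
  by apply: inner_eq_on => x _; rewrite hornerD hornerN subrK.
rewrite innerDl//; last exact: L2D.
rewrite !innerDr// (innerC _ (horner p') (horner (p - p'))) (Hpp _ sp') addr0 add0r lerDl.
exact: inner_ge0.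
Qed.

(** A polynomial p near f need not be orthogonal to the low degrees, hence need not be of the form L
    q. Subtracting its projection p' repairs this at no cost: <f, p - p'> = <f, p> since f is
    orthogonal to p', and |p - p'| <= |p|. *)
Lemma poincare K a b f g : -1 < a -> -1 < b ->
  in_L2 (W a b) f -> in_L2 (W (a + 1) (b + 1)) g -> is_wderive 1 f g ->
  perp (W a b) K f ->
  K%:R * (K%:R + a + b + 1) * inner (W a b) f f <= inner (W (a + 1) (b + 1)) g g.
Proof.
move=> a1 b1 Lf Lg fg.
case: K => [|K] pf; first by rewrite mul0r mul0r inner_weight_ge0.
have a2 : -1 < a + 1 by lra.
have b2 : -1 < b + 1 by lra.
have mw := @measurable_weight R a b Lambda.
have w0 := @weight_ge0 R a b.
have Iw := integrable_weight a1 b1.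
have Lh r := L2_horner mw w0 Iw r.
apply: poincare_limit; [exact: poincare_const_ge0|exact: inner_weight_ge0|exact:
  inner_weight_ge0|].
move=> e e0; have [p Hp] := poly_dense a1 b1 Lf e0.
have [fpE ppE] := sqdist_expand mw w0 Lf (Lh p).
have [p' [sp' Hp']] := inner_proj mw w0 Iw K.+1 (Lh p).
have Hpp : perp (W a b) K.+1 (horner (p - p')).
  move=> r sr; rewrite -(Hp' r sr); apply: inner_eq_on => x _; last by [].
  by rewrite hornerD hornerN.
have [q qE] : exists q, p - p' = jacobi_op a b q.
  by apply: (jacobi_op_range a1 b1); apply: Hpp; rewrite size_poly1.
exists (inner (W a b) f (fun x => f x - p.[x])),
  (inner (W a b) (fun x => f x - p.[x]) (fun x => f x - p.[x])),
  (ip (a + 1) (b + 1) q q); split.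
- by rewrite Hp inner_weight_ge0.
- by apply: inner_weight_CS => //; exact: L2B.
- rewrite -ppE; apply: le_trans (proj_le mw w0 Lh sp' Hpp).
  rewrite qE in Hpp *; apply: (poincare_op_poly a1 b1 _ Hpp) => pq.
  exact: (poincare_poly a2 b2 pq).
- rewrite -fpE.
  have -> : inner (W a b) f (horner p) = inner (W a b) f (horner (p - p')).
    rewrite -[LHS]subr0 -(pf _ sp') -innerBr//.
    by apply: inner_eq_on => x _ //; rewrite hornerD hornerN.
  rewrite qE (inner_jacobi_op q a1 b1 Lf Lg fg).
  by apply: (inner_weight_CS Lg); exact: L2_weight_horner.
Qed.

(** The factor K + a + b + 1 increases by one at each step, as K drops by one while a and b both
    rise, so the single lower bound c serves throughout; the factors K - i build the falling
    factorial. Orthogonality of [d m] is carried along, for the next step and for the final use of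
    Pythagoras. *)
Lemma poincare_iter m K a b (d : nat -> R -> R) (c : R) : -1 < a -> -1 < b ->
  0 <= c <= K%:R + a + b + 1 -> (m <= K)%N ->
  (forall l, (l <= m)%N -> in_L2 (W (a + l%:R) (b + l%:R)) (d l)) ->
  (forall l, (l < m)%N -> is_wderive 1 (d l) (d l.+1)) ->
  perp (W a b) K (d 0%N) ->
  perp (W (a + m%:R) (b + m%:R)) (K - m) (d m) /\
  c ^+ m * (K ^_ m)%:R * inner (W a b) (d 0%N) (d 0%N) <=
  inner (W (a + m%:R) (b + m%:R)) (d m) (d m).
Proof.
move=> a1 b1 /andP[c0 cK]; elim: m => [|m IH] mK Ld wd p0.
  by rewrite !addr0 subn0 expr0 ffactn0 !mul1r.
have m0 : 0 <= m%:R :> R by [].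
have am : -1 < a + m%:R by rewrite (lt_le_trans a1)// lerDl.
have bm : -1 < b + m%:R by rewrite (lt_le_trans b1)// lerDl.
have cle : c <= (K - m)%:R + (a + m%:R) + (b + m%:R) + 1.
  by rewrite (natrB _ (ltnW mK)); clear - cK m0; lra.
have [pm Hm] : perp (W (a + m%:R) (b + m%:R)) (K - m) (d m) /\
  c ^+ m * (K ^_ m)%:R * inner (W a b) (d 0%N) (d 0%N) <=
  inner (W (a + m%:R) (b + m%:R)) (d m) (d m).
  apply: IH => //; first exact: ltnW.
    by move=> l lm; apply: Ld; exact: leqW.
  by move=> l lm; apply: wd; exact: leqW.
have eS x : x + m.+1%:R = x + m%:R + 1 by rewrite -natr1 addrA.
have Lm := Ld m (leqnSn m).
have := Ld m.+1 (leqnn _); rewrite !eS => LmS.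
have wm := wd m (ltnSn m).
have KmE : (K - m = (K - m.+1).+1)%N by rewrite subnSK.
split.
  by apply: perp_derive am bm Lm LmS wm _; rewrite -KmE.
apply: le_trans (poincare am bm Lm LmS wm pm).
rewrite ffactnSr natrM exprSr.
rewrite (_ : _ * _ = (K - m)%:R * c * (c ^+ m * (K ^_ m)%:R * inner (W a b) (d 0%N) (d
  0%N))); last by ring.
apply: ler_pM => //.
- by rewrite mulr_ge0.
- apply: mulr_ge0 (inner_weight_ge0 _ _ _).
  exact: mulr_ge0 (exprn_ge0 _ c0) (ler0n _ _).
- by rewrite ler_wpM2l.
Qed.

(** * Riemann-Liouville derivatives as weak derivatives *)

Lemma RL_indexD (al : R) l : 0 < al -> RL_index (al + l%:R) = (RL_index al + l)%N.
Proof.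
move=> al0; rewrite /RL_index addSn; congr S; apply: truncn_def.
have /andP[h1 h2] := truncn_itv (ltW al0).
by rewrite -addSn !natrD lerD2r h1 ltrD2r.
Qed.

(** The kernel exponent s - j + 1 is the fractional part of s, which adding an integer does not
    change. *)
Lemma RL_integralD (al : R) l u : 0 < al -> RL_integral (al + l%:R) u = RL_integral al u.
Proof.
move=> al0; apply/funext => x; rewrite /RL_integral /RL_kernel (RL_indexD l al0).
have -> : al + l%:R - (RL_index al + l)%:R + 1 = al - (RL_index al)%:R + 1
  by rewrite natrD; ring.
by [].
Qed.

(** The Gamma factor also depends on the fractional part alone. The constant of order al is moved
    into the differentiated function, which is then the same for all l; the sign (-1)^l is what
    remains. *)
Lemma RL_derive_wderive (al : R) l u : 0 < al -> RL_derivable (al + l%:R) u ->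
  is_wderive (RL_index al + l) (fun x =>
    (-1) ^+ RL_index al / Gamma ((RL_index al)%:R - al) * RL_integral al u x)
    (fun x => (-1) ^+ l * RL_derive (al + l%:R) u x).
Proof.
move=> al0 [_]; rewrite RL_integralD// RL_indexD// => /wderiveP.
move=> /(is_wderiveZ ((-1) ^+ RL_index al / Gamma ((RL_index al)%:R - al))).
apply: is_wderive_eq => // x _.
rewrite /RL_derive RL_indexD// RL_integralD//.
rewrite (_ : (RL_index al + l)%:R - (al + l%:R) = (RL_index al)%:R - al);
  last by rewrite natrD; ring.
rewrite exprD !mulrA; congr (_ * _ * _).
by rewrite -mulrA mulrC -mulrA -exprMn mulrNN mulr1 expr1n mulr1.
Qed.

(** Equality holds only almost everywhere because [RL_derive] uses a chosen representative of the
    weak derivative. *)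
Lemma Fplus_RL_surj (al : R) N q : 0 < al -> polys N q -> exists v,
  [/\ Fplus al N v, RL_derivable al v & {ae mu, forall x,
    Lambda x -> RL_derive al v x = q.[x]}].
Proof.
move=> al0 /polys_RL_sum[t ->]; have [r <-] := RL_sum_intK al0 t N.+1.
pose v x := (1 - x) `^ al * (RL_sum r N.+1).[x].
have Iv x : Lambda x -> mu.-integrable `]x, 1[ (fun y => (RL_kernel al v x y)%:E) /\
    RL_integral al v x = (RL_sum_int al r N.+1).[x].
  by move=> /LambdaP/andP[_ x1]; exact: RL_integral_sum.
have wv : is_wderive (RL_index al) (RL_integral al v) (horner (RL_sum_int al r
  N.+1)^`(RL_index al)).
  by apply: is_wderive_eq (is_wderive_horner _ _) => // x /Iv[_ ->].
have dv : RL_derivable al v.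
  split; last by eexists; exact: wv.
  by apply: aeW => x /Iv[].
exists v; split => //; first by exists (RL_sum r N.+1) => //; exact: RL_sum_polys.
have [_ /wderiveP wv'] := dv.
apply: ae_imply (is_wderive_unique wv' wv) => x H Lx.
by rewrite /RL_derive H// hornerZ.
Qed.

(** The integral of v - u is the difference of the integrals for almost every x. Its weak
    differentiability is assumed separately, since it includes Borel measurability, which equality
    almost everywhere does not transfer by itself. *)
Lemma RL_deriveB_ae (al : R) v u : 0 < al -> RL_derivable al v -> RL_derivable al u ->
  wderivable (RL_index al) (RL_integral al (fun x => v x - u x)) ->
  {ae mu, forall x, Lambda x -> RL_derive al (fun x =>
    v x - u x) x = RL_derive al v x - RL_derive al u x}.
Proof.
move=> al0 [Iv /wderiveP wv] [Iu /wderiveP wu] /wderiveP w.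
have [lw _ _] := w.
have E : {ae mu, forall x, Lambda x ->
    RL_integral al v x - RL_integral al u x = RL_integral al (fun x => v x - u x) x}.
  apply: ae_imply2 Iv Iu => x Ivx Iux Lx; rewrite /RL_integral -RintegralB//;
    [|exact: Ivx|exact: Iux].
  by apply: eq_Rintegral => y _; rewrite /RL_kernel mulrBl.
have := is_wderive_unique (is_wderive_eq_ae (is_wderiveB wv wu) lw E) w.
by apply: ae_imply => x H Lx; rewrite /RL_derive -H// mulrBr.
Qed.

End poincare.

(** * The projection error *)

Section error.
Context {R : realType}.
Implicit Types (f g h u : R -> R) (a b c x y e : R) (n k K l m N : nat) (p q r : {poly R}).
Local Notation mu := (@lebesgue_measure R).
Local Notation Lambda := (@Lambda R).
Local Notation W := (@jacobi_weight R).

Lemma size_derivn_le p N m : (size p <= N)%N -> (size p^`(m) <= N - m)%N.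
Proof.
move=> sp; apply/leq_sizeP => j; rewrite leq_subLR => Nj.
by rewrite coef_derivn nth_default ?mul0rn// (leq_trans sp).
Qed.

(** [orth_proj] and [plus_pi] are values of [xget]; [inner_proj] and [Fplus_RL_surj] provide the
    witnesses that make them meet their specifications. *)
Lemma plus_pi_spec alpha beta N u : 0 < alpha -> -1 < alpha + beta ->
  in_L2 (W 0 (alpha + beta)) (RL_derive alpha u) ->
  exists q, [/\ polys N q,
    perp (W 0 (alpha + beta)) N.+1 (fun x => RL_derive alpha u x - q.[x]),
    RL_derivable alpha (plus_pi alpha beta N u) &
    {ae mu, forall x, Lambda x -> RL_derive alpha (plus_pi alpha beta N u) x = q.[x]}].
Proof.
move=> al0 ga Lu.
have m0 : -1 < 0 :> R by rewrite ltrN10.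
have [q0 [sq0 Hq0]] := inner_proj (@measurable_weight R 0 (alpha
  + beta) Lambda) (weight_ge0 0 (alpha + beta))
  (integrable_weight m0 ga) N.+1 Lu.
pose q := orth_proj (W 0 (alpha + beta)) N (RL_derive alpha u).
have [sq Hq] : polys N q /\ forall r, polys N r ->
    inner (W 0 (alpha + beta)) (fun x => RL_derive alpha u x - q.[x]) (horner r) = 0.
  by rewrite /q /orth_proj; case: xgetP => [q' -> //|/(_ q0)[]].
have [v [Fv dv ev]] := Fplus_RL_surj al0 sq.
have [dp ep] : RL_derivable alpha (plus_pi alpha beta N u) /\
    {ae mu, forall x, Lambda x -> RL_derive alpha (plus_pi alpha beta N u) x = q.[x]}.
  by rewrite /plus_pi; case: xgetP => [p -> []//|/(_ v)[]].
by exists q; split.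
Qed.

(** With E l = (-1)^l D_+^(alpha+l) u - q^(l), the iterated inequality bounds E 0 by E m. Since E m
    is orthogonal to q^(m), its norm is at most that of E m + q^(m), which is D_+^(alpha+m) u up to
    sign. *)
Lemma projection_error alpha beta m N u : 0 < alpha -> -1 < alpha + beta -> (m <= N)%N ->
  (forall l, (l <= m)%N ->
     RL_derive_in_L2 (alpha + l%:R) (W l%:R (alpha + beta + l%:R)) u) ->
  forall err, err = RL_derive alpha (fun x => plus_pi alpha beta N u x - u x) ->
  N%:R ^+ m * (N.+1 ^_ m)%:R * inner (W 0 (alpha + beta)) err err <=
  inner (W m%:R (alpha + beta + m%:R)) (RL_derive (alpha + m%:R) u) (RL_derive (alpha
    + m%:R) u).
Proof.
move=> al0 ga mN Hu err errE.
have m0 : -1 < 0 :> R by rewrite ltrN10.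
have [du Lu] : RL_derive_in_L2 alpha (W 0 (alpha + beta)) u.
  by have := Hu 0%N isT; rewrite !addr0.
have [q [sq pq dp ep]] := plus_pi_spec N al0 ga Lu.
(* Without a weak derivative of order RL_index, RL_derive has the junk value 0. *)
have [wd|nwd] := pselect (wderivable (RL_index alpha)
    (RL_integral alpha (fun x => plus_pi alpha beta N u x - u x))); last first.
  have -> : err = cst 0.
    by rewrite errE; apply/funext => x; rewrite /RL_derive wderive_out// mulr0.
  rewrite /inner (@eq_Rintegral _ _ _ mu _ (cst 0)); last by move=> x _; rewrite /= !mul0r.
  by rewrite Rintegral_zero mulr0 inner_weight_ge0.
pose d l x := (-1) ^+ l * RL_derive (alpha + l%:R) u x.
pose E l x := d l x - q^`(l).[x].
have wdd l : (l <= m)%N -> is_wderive (RL_index alpha + l)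
    (fun x => (-1) ^+ RL_index alpha / Gamma ((RL_index alpha)%:R
      - alpha) * RL_integral alpha u x) (d l).
  by move=> lm; have [dl _] := Hu l lm; exact: (RL_derive_wderive al0 dl).
have Ld l : (l <= m)%N -> in_L2 (W (0 + l%:R) (alpha + beta + l%:R)) (d l).
  by move=> lm; rewrite add0r; have [_ Ll] := Hu l lm; exact: (L2Z _ Ll).
have w1 (l : nat) : -1 < 0 + l%:R :> R by rewrite add0r (lt_le_trans m0).
have w2 (l : nat) : -1 < alpha + beta + l%:R by rewrite (lt_le_trans ga)// lerDl.
have LE l : (l <= m)%N -> in_L2 (W (0 + l%:R) (alpha + beta + l%:R)) (E l).
  move=> lm; apply: L2B; [exact: measurable_weight|exact: weight_ge0|exact: Ld|].
  exact: L2_weight_horner.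
have wE l : (l < m)%N -> is_wderive 1 (E l) (E l.+1).
  move=> lm; apply: is_wderiveB; last by rewrite derivnS; exact: is_wderive1_horner.
  apply: is_wderive_shift (wdd l (ltnW lm)) _.
  by rewrite addn1 -addnS; exact: wdd.
have E0 : E 0%N = (fun x => RL_derive alpha u x - q.[x]).
  by apply/funext => x; rewrite /E /d expr0 mul1r addr0 derivn0.
have pE : perp (W 0 (alpha + beta)) N.+1 (E 0%N) by rewrite E0; exact: pq.
(* The sum on the right is N + 2 + (alpha + beta), greater than N + 1; the smaller value c = N
   produces the power N^(-m/2). *)
have cN : 0 <= (N%:R : R) <= N.+1%:R + 0 + (alpha + beta) + 1.
  by apply/andP; split => //; rewrite -natr1; clear - ga; lra.
have [pm Hm] := poincare_iter m0 ga cN (leqW mN) LE wE pE.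
have -> : inner (W 0 (alpha + beta)) err err = inner (W 0 (alpha + beta)) (E 0%N) (E 0%N).
  transitivity (inner (W 0 (alpha + beta)) (fun x => -1 * E 0%N x) (fun x =>
    -1 * E 0%N x)); last first.
    by apply: eq_Rintegral => x _; ring.
  rewrite errE; apply: inner_ae_eq.
  - exact: measurable_weight.
  - have [_ lw _] := wderiveP wd.
    by have [] := locally_integrableZ ((-1) ^+ RL_index alpha / Gamma ((RL_index alpha)%:R
      - alpha)) lw.
  - by apply: measurable_funM => //; have [] := LE 0%N isT.
  apply: ae_imply2 (RL_deriveB_ae al0 dp du wd) ep => x H1 H2 Lx.
  by rewrite E0 (H1 Lx) (H2 Lx); ring.
apply: (le_trans Hm).
have Lq := @L2_weight_horner R _ _ q^`(m) (w1 m) (w2 m).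
have LEm := LE m (leqnn m).
have -> : inner (W m%:R (alpha + beta + m%:R)) (RL_derive (alpha
  + m%:R) u) (RL_derive (alpha + m%:R) u) =
   inner (W (0 + m%:R) (alpha + beta + m%:R)) (fun x => E m x + q^`(m).[x]) (fun x =>
     E m x + q^`(m).[x]).
  rewrite add0r; apply: eq_Rintegral => x _; rewrite /E subrK /d.
  have s1 : (-1) ^+ m * (-1) ^+ m = 1 :> R by rewrite -exprMn mulrNN mulr1 expr1n.
  have eqs (X Y : R) : X * X * Y = (-1) ^+ m * X * ((-1) ^+ m * X) * Y.
    transitivity ((-1) ^+ m * (-1) ^+ m * (X * X * Y)); first by rewrite s1 mul1r.
    by move: ((-1) ^+ m) => s; ring.
  exact: eqs.
have mw := @measurable_weight R (0 + m%:R) (alpha + beta + m%:R) Lambda.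
have w0 := @weight_ge0 R (0 + m%:R) (alpha + beta + m%:R).
(* q has size at most N + 1, so q^(m) has size at most N + 1 - m, exactly the range covered by
   [pm]. *)
have Eq0 : inner (W (0 + m%:R) (alpha + beta + m%:R)) (E m) (horner q^`(m)) = 0.
  by apply: pm; exact: size_derivn_le.
rewrite (innerDl mw w0 LEm Lq (L2D mw w0 LEm Lq)).
rewrite (innerDr mw w0 LEm Lq LEm) (innerDr mw w0 LEm Lq Lq) (innerC _ (horner q^`(m)) (E
  m)) Eq0 addr0 lerDl.
by apply: addr_ge0 => //; exact: inner_weight_ge0.
Qed.

(** * The constants and their limit *)

Lemma ratio_fact N m : (m <= N)%N ->
  (N - m + 1)`!%:R / (N + 1)`!%:R = ((N.+1 ^_ m)%:R)^-1 :> R.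
Proof.
move=> mN; rewrite !addn1 -(ffact_fact (leqW mN)) subSn// natrM.
have f1 : (N - m).+1`!%:R != 0 :> R by rewrite pnatr_eq0 -lt0n fact_gt0.
by rewrite invfM mulrCA divff// mulr1.
Qed.

(** Passing from m to m + 1 multiplies the ratio by N / (N + 1 - m) = 1 / (1 + (1 - m)/N), which
    tends to 1. *)
Lemma cvg_ratio m : (N%:R ^+ m / (N.+1 ^_ m)%:R) @[N --> \oo] --> (1 : R).
Proof.
elim: m => [|m IH].
  by apply: cvg_near_cst; near=> N; rewrite expr0 ffactn0 divr1.
have c0 : N%:R^-1 @[N --> \oo] --> (0 : R).
  apply/(@gtr0_cvgV0 _ _ _ _ (fun N => N%:R)); last exact: cvgr_idn.
  by exists 1%N => // n /= n1; rewrite ltr0n.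
have c1 : (1 + (1 - m%:R) * N%:R^-1)^-1 @[N --> \oo] --> (1 : R).
  have c2 : 1 + (1 - m%:R) * N%:R^-1 @[N --> \oo] --> (1 + (1 - m%:R) * 0 : R).
    by apply: cvgD; [exact: cvg_cst|apply: cvgM; [exact: cvg_cst|exact: c0]].
  rewrite mulr0 addr0 in c2.
  have c3 : (1 + (1 - m%:R) * N%:R^-1)^-1 @[N --> \oo] --> (1^-1 : R).
    by apply: cvgV c2; exact: oner_neq0.
  by rewrite invr1 in c3.
have c4 : N%:R ^+ m / (N.+1 ^_ m)%:R * (1
  + (1 - m%:R) * N%:R^-1)^-1 @[N --> \oo] --> (1 * 1 : R).
  by apply: cvgM.
rewrite mulr1 in c4; apply: cvg_trans c4; apply: near_eq_cvg.
near=> N.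
have mN : (m < N)%N by near: N; exact: nbhs_infty_gt.
have N0 : N%:R != 0 :> R by rewrite pnatr_eq0 -lt0n (leq_ltn_trans _ mN).
have d0 : N%:R + 1 - m%:R != 0 :> R.
  by rewrite gt_eqF// natr1 subr_gt0 ltr_nat leqW.
have f2 : (N.+1 ^_ m)%:R != 0 :> R by rewrite pnatr_eq0 -lt0n ffact_gt0 leqW// ltnW.
rewrite ffactnSr exprSr natrM natrB; last by rewrite leqW// ltnW.
rewrite -natr1 (_ : 1 + (1 - m%:R) / N%:R = (N%:R + 1 - m%:R) / N%:R); last by field.
by field; rewrite f2 d0 N0.
Unshelve. all: by end_near. Qed.

Lemma powR_half_sqrt N m : N%:R `^ (- (m%:R / 2)) = Num.sqrt (N%:R ^- m) :> R.
Proof.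
have e : - (m%:R / 2) = - m%:R * 2^-1 :> R by rewrite mulNr.
by rewrite e powRrM powR12_sqrt ?powR_ge0// powR_invn.
Qed.

End error.

Theorem theorem2 (R : realType) (alpha beta : R)
  (halpha : 0 < alpha) (hbeta1 : - alpha - 1 < beta) (hbeta2 : beta < -1)
  (hbetaN : forall k : nat, (0 < k)%N -> - beta <> k%:R) :
  (forall (m N : nat) (u : R -> R), (1 <= N)%N -> (m <= N)%N ->
     (forall l : nat, (l <= m)%N ->
        RL_derive_in_L2 (alpha + l%:R)
          (jacobi_weight l%:R (alpha + beta + l%:R)) u) ->
     wnorm (jacobi_weight 0 (alpha + beta))
       (RL_derive alpha (fun x => plus_pi alpha beta N u x - u x))
     <= N%:R `^ (- (m%:R / 2)) *
        Num.sqrt ((N - m + 1)`!%:R / (N + 1)`!%:R) *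
        wnorm (jacobi_weight m%:R (alpha + beta + m%:R))
          (RL_derive (alpha + m%:R) u))
  /\
  (forall m : nat, exists c : nat -> R,
     [/\ forall N : nat, 0 < c N,
         c n @[n --> \oo] --> (1 : R) &
         forall (N : nat) (u : R -> R), (1 <= N)%N -> (m <= N)%N ->
           (forall l : nat, (l <= m)%N ->
              RL_derive_in_L2 (alpha + l%:R)
                (jacobi_weight l%:R (alpha + beta + l%:R)) u) ->
           wnorm (jacobi_weight 0 (alpha + beta))
             (RL_derive alpha (fun x => plus_pi alpha beta N u x - u x))
           <= c N * N%:R ^- m *
              wnorm (jacobi_weight m%:R (alpha + beta + m%:R))
                (RL_derive (alpha + m%:R) u)]).
Proof.
have ga : -1 < alpha + beta by lra.
have main (m N : nat) (u : R -> R) : (1 <= N)%N -> (m <= N)%N ->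
     (forall l : nat, (l <= m)%N ->
        RL_derive_in_L2 (alpha + l%:R)
          (jacobi_weight l%:R (alpha + beta + l%:R)) u) ->
     wnorm (jacobi_weight 0 (alpha + beta))
       (RL_derive alpha (fun x => plus_pi alpha beta N u x - u x))
     <= N%:R `^ (- (m%:R / 2)) *
        Num.sqrt ((N - m + 1)`!%:R / (N + 1)`!%:R) *
        wnorm (jacobi_weight m%:R (alpha + beta + m%:R))
          (RL_derive (alpha + m%:R) u).
  move=> N1 mN Hu; have := projection_error halpha ga mN Hu erefl.
  rewrite /wnorm ratio_fact// powR_half_sqrt.
  move: (inner _ _ _) (inner _ _ _) => A B AB.
  have N0 : 0 < N%:R ^+ m :> R by rewrite exprn_gt0// ltr0n.
  have f0 : 0 < (N.+1 ^_ m)%:R :> R by rewrite ltr0n ffact_gt0 leqW.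
  have X0 : 0 <= N%:R ^- m :> R by rewrite invr_ge0 ltW.
  have Y0 : 0 <= (N.+1 ^_ m)%:R^-1 :> R by rewrite invr_ge0 ltW.
  rewrite -(sqrtrM _ X0) -(sqrtrM _ (mulr_ge0 X0 Y0)); apply: ler_wsqrtr.
  by rewrite -invfM mulrC ler_pdivlMr ?mulr_gt0// mulrC.
split=> // m.
(* Solves N^(-m/2) sqrt((N-m+1)!/(N+1)!) = c N^(-m). The value 1 elsewhere keeps c positive: for m >
   N + 1 the falling factorial is 0, and so would be the quotient. *)
pose c N : R := if (m <= N)%N && (1 <= N)%N then Num.sqrt (N%:R ^+ m / (N.+1 ^_ m)%:R) else 1.
exists c; split.
- move=> N; rewrite /c; case: ifP => // /andP[mN N1].
  by rewrite sqrtr_gt0 divr_gt0 ?exprn_gt0 ?ltr0n ?ffact_gt0// leqW.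
- have c1 : Num.sqrt (N%:R ^+ m / (N.+1 ^_ m)%:R) @[N --> \oo] --> (Num.sqrt 1 : R).
    by apply: cvg_comp (@cvg_ratio R m) _; exact: sqrt_continuous.
  rewrite sqrtr1 in c1; apply: cvg_trans c1; apply: near_eq_cvg; near=> N.
  rewrite /c ifT//; apply/andP; split; near: N; exact: nbhs_infty_ge.
move=> N u N1 mN Hu; apply: le_trans (main m N u N1 mN Hu) _.
rewrite ler_wpM2r ?sqrtr_ge0// /c mN N1 /= ratio_fact// powR_half_sqrt.
have N0 : 0 < N%:R ^+ m :> R by rewrite exprn_gt0// ltr0n.
have N0' := ltW N0; have Ni : 0 <= N%:R ^- m :> R by rewrite invr_ge0.
rewrite (sqrtrM _ N0') (sqrtrV N0').
have s0 : Num.sqrt (N%:R ^+ m) != 0 :> R by rewrite sqrtr_eq0 -ltNge.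
have sE : N%:R ^+ m = Num.sqrt (N%:R ^+ m) * Num.sqrt (N%:R ^+ m) :> R.
  by rewrite -expr2 sqr_sqrtr.
rewrite [X in _ * X^-1]sE; move: (Num.sqrt (_ ^+ m)) (Num.sqrt _^-1) s0 => s t s0.
rewrite le_eqVlt; apply/orP; left; apply/eqP; by field.
Unshelve. all: by end_near. Qed.
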